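(* Let $n\geq 8$ be divisible by $4$, let $k=\frac{n}{2}$, and let $G$ be a balanced $k$-partite graph on $n$ vertices. If $$\delta(G)\geq \frac{n}{2}+\left\lfloor\frac{n+2}{k+2}\right\rfloor-\frac{n}{k}=\frac{n}{2}-1$$ and $G$ does not have a Hamiltonian cycle, then $G\in\mathcal{F}_1$, or $n=8$ and $G\cong F_2$, or $G\in\mathcal{F}_3$, where $\mathcal{F}_1$, $F_2$, $\mathcal{F}_3$ are as defined in the context.
   Context: All graphs are finite and simple. A balanced $k$-partite graph on $n$ vertices is a graph whose vertex set is partitioned into $k$ independent sets (parts), each of size exactly $n/k$; here $k=n/2$, so each part has size $2$. $\delta(G)$ denotes the minimum degree. Write $[k]=\{1,\dots,k\}$. Let $n\ge 8$ be divisible by $4$ and $k=n/2$. Membership in the families below means membership for some labelling of the parts and vertices. Family $\mathcal{F}_1$: balanced $k$-partite graphs on $n$ vertices with parts $V_i=\{x_i,y_i\}$, $i\in[k]$, such that: $\{x_1,\dots,x_k\}$ is a clique; $y_k$ is adjacent to all of $y_1,\dots,y_{k-1}$; each $y_i$ with $i\in[k-1]$ is adjacent to at least $k-1$ of the $k$ vertices in $\{y_1,\dots,y_{i-1},y_{i+1},\dots,y_k\}\cup\{x_k\}$; and there are no other edges (that is, every edge lies inside $\{x_1,\dots,x_k\}$, or inside $\{y_1,\dots,y_k\}$, or joins $x_k$ to some $y_i$ with $i\in[k-1]$). Graph $F_2$: the graph on the $8$ vertices $x_1,x_2,x_3,x_4,x_5,x_6,x',x''$ in which $x_1$ and $x_4$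 are non-adjacent, each of $x_1,x_4$ is adjacent to all of $x_2,x_3,x_5,x_6,x',x''$, and the only other edges are $x_2x_3$, $x_5x_6$, $x'x''$. Family $\mathcal{F}_3$: balanced $k$-partite graphs on $n$ vertices with parts labelled $X_1,\dots,X_{k/2},Y_1,\dots,Y_{k/2}$ (each of size $2$), $X=\bigcup_{i=1}^{k/2}X_i$, $Y=\bigcup_{i=1}^{k/2}Y_i$, for which there are vertices $y'\in Y_{k/2}$, $y''\in Y\setminus\{y'\}$ and $x'\in X$ such that the edge set consists of: all edges between $X$ and $Y\setminus\{y',y''\}$; all edges from $y''$ to $X\setminus\{x'\}$; all edges from $y'$ to $\{x'\}\cup(Y\setminus Y_{k/2})$; optionally any number of further edges between different parts among $Y_1,\dots,Y_{k/2}$; and optionally the edge $x'y''$. There are no other edges. *)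

(* Defs.v *)
From mathcomp Require Import all_boot.

Set Implicit Arguments.
Unset Strict Implicit.
Unset Printing Implicit Defensive.

Record sgraph := SGraph {
  vertex :> finType;
  adj : rel vertex;
  adj_sym : symmetric adj;
  adj_irrefl : irreflexive adj
}.

Definition isomorphic (G H : sgraph) : Prop :=
  exists f : G -> H, bijective f /\ forall u v, adj (f u) (f v) = adj u v.

Definition degree (G : sgraph) (u : G) : nat := #|[set v | adj u v]|.

(* The default value #|G| is larger than every degree, so on a nonempty graph
   this is the minimum of the degrees. *)
Definition min_degree (G : sgraph) : nat :=
  \big[minn/#|G|]_(u : G) degree u.

Definition hamiltonian (G : sgraph) : Prop :=
  exists c : seq G, [/\ 2 < size c, ucycle (@adj G) c & forall u, u \in c].

Definition independent (G : sgraph) (A : {set G}) : Prop :=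
  {in A &, forall u v, ~~ adj u v}.

Definition balanced_partite (G : sgraph) (k : nat) (P : {set {set G}}) : Prop :=
  [/\ partition P [set: G], #|P| = k
    & {in P, forall A : {set G}, independent A /\ #|A| = #|G| %/ k}].

(* In both families below the parts are indexed by an ordinal type, and the
   distinguished last index (k for F1, k/2 for F3) is an index l chosen together
   with the labelling. As P has exactly k members, the labelling of the parts
   is necessarily without repetition. *)
Definition family_F1 (G : sgraph) (k : nat) (P : {set {set G}}) : Prop :=
  balanced_partite k P /\
  exists (x y : 'I_k -> G) (l : 'I_k),
    [/\ P = [set [set x i; y i] | i : 'I_k],
        forall i j, i != j -> adj (x i) (x j),
        forall i, i != l -> adj (y l) (y i),
        forall i, i != l ->
          k - 1 <= #|[set v in x l |: [set y j | j : 'I_k & j != i]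
                      | adj (y i) v]|
      & forall u v, adj u v ->
          [\/ u \in codom x /\ v \in codom x,
              u \in codom y /\ v \in codom y
            | exists2 i, i != l & [set u; v] = [set x l; y i]]].

(* The ordinal i : 'I_8 is the vertex number i + 1: numbers 1 to 6 are
   x_1, ..., x_6, number 7 is x' and number 8 is x''. *)
Definition F2_edges : seq (nat * nat) :=
  [seq (h, v) | h <- [:: 1; 4], v <- [:: 2; 3; 5; 6; 7; 8]]
  ++ [:: (2, 3); (5, 6); (7, 8)].

Definition F2_adj : rel 'I_8 := fun u v =>
  ((u.+1, v.+1) \in F2_edges) || ((v.+1, u.+1) \in F2_edges).

Lemma F2_adj_sym : symmetric F2_adj.
Proof. by move=> u v; rewrite /F2_adj orbC. Qed.

Lemma F2_adj_irrefl : irreflexive F2_adj.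
Proof. by case; do 8!case=> //. Qed.

Definition F2 : sgraph := SGraph F2_adj_sym F2_adj_irrefl.

Definition family_F3 (G : sgraph) (k : nat) (P : {set {set G}}) : Prop :=
  balanced_partite k P /\
  exists (X Y : 'I_(k %/ 2) -> {set G}) (l : 'I_(k %/ 2)) (y' y'' x' : G),
    let XX := \bigcup_i X i in
    let YY := \bigcup_i Y i in
    let required : rel G := fun u v =>
      [|| (u \in XX) && (v \in YY :\: [set y'; y'']),
          (u == y'') && (v \in XX :\ x')
        | (u == y') && (v \in x' |: (YY :\: Y l))] in
    let optional : rel G := fun u v =>
      [exists i, exists j, [&& i != j, u \in Y i & v \in Y j]]
      || (u == x') && (v == y'') in
    [/\ P = [set X i | i : 'I_(k %/ 2)] :|: [set Y i | i : 'I_(k %/ 2)],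
        [/\ y' \in Y l, y'' \in YY :\ y' & x' \in XX],
        forall u v, required u v -> adj u v
      & forall u v, adj u v ->
          [|| required u v, required v u, optional u v | optional v u]].

(* Main.v *)
Require Import Defs.
From mathcomp Require Import all_boot zify.
From Stdlib Require Import Classical_Prop.

Set Implicit Arguments.
Unset Strict Implicit.
Unset Printing Implicit Defensive.

(* With [n = 2k] the degree condition is [k - 1 <= deg], and non-Hamiltonicity
   is forced by one of three obstructions that persist when edges are deleted: a
   cut vertex, a set of [k + 1] vertices spanning at most one edge, or (for
   [k = 4]) the shape of F2. By induction on the number of non-edges one may
   assume that adding some edge [uw] creates a Hamiltonian cycle, that is, a
   Hamiltonian path [p] from [u] to [w]. If some neighbour of [w] precedes some
   neighbour of [u] on [p], the degree condition yields such a pair at distance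
   at most 3, hence a cycle of length at least [n - 2]; around such a cycle the
   neighbours of the missing vertices are so regularly spaced that one of the
   last two obstructions appears. Otherwise all neighbours of [u] precede those
   of [w] and chords over the meeting point give a Hamiltonian cycle, unless
   there is a cut vertex.

   In a partite graph the non-adjacent pairing given by the parts turns the
   obstructions into the three families; since [k + 1] is odd, one vertex of a
   set of [k + 1] vertices spanning at most one edge has its partner outside,
   and this vertex is the [y'] of F3. *)

(** * Cycles along enumerations of vertices *)

Definition inj_below (T : Type) (n : nat) (v : nat -> T) :=
  forall i j, i < n -> j < n -> v i = v j -> i = j.

Definition has_cycle (T : Type) (e : rel T) (m : nat) :=
  exists v : nat -> T,
    [/\ inj_below m v, forall i, i.+1 < m -> e (v i) (v i.+1)
      & e (v m.-1) (v 0)].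

(** The rerouted cycles below are given by an explicit map [g] on the indices of a known path or
    cycle, so that distinctness of their vertices becomes arithmetic on indices. *)
Lemma reindexed_cycle (T : Type) (e : rel T) (n m : nat) (v : nat -> T)
    (g : nat -> nat) :
  inj_below n v -> (forall i, i < m -> g i < n) -> inj_below m g ->
  (forall i, i.+1 < m -> e (v (g i)) (v (g i.+1))) ->
  e (v (g m.-1)) (v (g 0)) -> has_cycle e m.
Proof.
move=> v_inj g_lt g_inj g_edge g_close; exists (v \o g); split=> // i j lt_i lt_j.
by move=> /(v_inj _ _ (g_lt _ lt_i) (g_lt _ lt_j)); apply: g_inj.
Qed.

Definition path_edges (T : Type) (e : rel T) (n : nat) (p : nat -> T) :=
  forall i j, i < n -> j < n -> (j = i.+1) \/ (i = j.+1) -> e (p i) (p j).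

Lemma edge_at (T : Type) (e : rel T) (v : nat -> T) (s t : nat) :
  e (v s) (v t) -> forall i j, i = s -> j = t -> e (v i) (v j).
Proof. by move=> est i j -> ->. Qed.
Arguments edge_at {T} e v {s t} _ i j _ _.

(* [lia] would branch on the boolean atoms of the other hypotheses. *)
Ltac nat_lia :=
  repeat match goal with
  | H : ?A |- _ =>
    lazymatch A with
    | nat => fail
    | or _ _ => fail
    | Equality.sort _ => fail
    | is_true (leq _ _) => fail
    | is_true (andb _ _) => fail
    | is_true (eq_op _ _) => fail
    | is_true (negb (eq_op _ _)) => fail
    | is_true (negb (leq _ _)) => fail
    | @eq nat _ _ => fail
    | @eq (Equality.sort _) _ _ => fail
    | not (@eq nat _ _) => fail
    | @eq bool (leq _ _) _ => fail
    | @eq bool (eq_op _ _) _ => fail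
    | _ => clear H
    end
  end; lia.

Ltac cases_lia :=
  first [move=> ? ? ? ? /= | move=> ? ? /=]; repeat case: ifP; nat_lia.

(** The cycle runs from [p 0] up to [p t], jumps to [p n.-1], descends to [p s] and returns to
    [p 0]; only the vertices strictly between [t] and [s] are lost. *)
Lemma crossing_ends_cycle (T : Type) (e : rel T) (n s t : nat) (p : nat -> T) :
  symmetric e -> inj_below n p -> path_edges e n p ->
  t < s < n -> e (p 0) (p s) -> e (p n.-1) (p t) ->
  has_cycle e (t.+1 + (n - s)).
Proof.
move=> e_sym p_inj p_edge lt_tsn e0s; rewrite e_sym => /(edge_at e p) et.
move: e0s; rewrite e_sym => /(edge_at e p) es.
apply: (@reindexed_cycle _ e n _ p
  (fun i => if i <= t then i else n.-1 - (i - t.+1))) => //.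
- by cases_lia.
- by cases_lia.
- move=> i lt_i /=; repeat case: ifP => *;
    first [nat_lia | by apply: p_edge; nat_lia | by apply: et; nat_lia].
- by move=> /=; repeat case: ifP => *; first [by apply: es; nat_lia | nat_lia].
Qed.

(** The route is: up from [p 0] to [p s], over the chord to [p t], up to [p n.-1], across to [p t'],
    down to [p s'], back to [p 0]. It omits the indices strictly between [s] and [s'] and strictly
    between [t'] and [t]. *)
Lemma crossing_chord_cycle (T : Type) (e : rel T) (n s s' t' t : nat)
    (p : nat -> T) :
  symmetric e -> inj_below n p -> path_edges e n p ->
  s < s' -> s' <= t' -> t' < t < n ->
  e (p s) (p t) -> e (p 0) (p s') -> e (p n.-1) (p t') ->
  has_cycle e (s.+1 + (n - t) + (t' - s').+1).
Proof.
move=> e_sym p_inj p_edge lt_ss' le_st' lt_tn /(edge_at e p) est es /(edge_at e p) et.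
move: es; rewrite e_sym => /(edge_at e p) es.
apply: (@reindexed_cycle _ e n _ p
  (fun i => if i <= s then i else
            if i < s.+1 + (n - t) then t + (i - s.+1)
            else t' - (i - (s.+1 + (n - t))))) => //.
- by cases_lia.
- by cases_lia.
- move=> i lt_i /=; repeat case: ifP => *;
    first [nat_lia | by apply: p_edge; nat_lia | by apply: est; nat_lia | by apply: et; nat_lia].
- by move=> /=; repeat case: ifP => *; first [by apply: es; nat_lia | nat_lia].
Qed.

(** The route is: down from [p s] to [p 0], across to [p s.+1], up to [p i], across to [p t], up to
    [p n.-1], across to [p t.-1], down to [p i.+1], back to [p s]. *)
Lemma two_chords_cycle (T : Type) (e : rel T) (n s i t : nat) (p : nat -> T) :
  symmetric e -> inj_below n p -> path_edges e n p ->
  s < i -> i.+1 < t < n -> e (p i) (p t) -> e (p s) (p i.+1) ->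
  e (p 0) (p s.+1) -> e (p n.-1) (p t.-1) -> has_cycle e n.
Proof.
move=> e_sym p_inj p_edge lt_si lt_tn /(edge_at e p) eit es /(edge_at e p) e0 /(edge_at e p) et.
move: es; rewrite e_sym => /(edge_at e p) es.
apply: (@reindexed_cycle _ e n _ p
  (fun j => if j <= s then s - j else
            if j <= i then j else
            if j < i.+1 + (n - t) then t + (j - i.+1)
            else t.-1 - (j - (i.+1 + (n - t))))) => //.
- by cases_lia.
- by cases_lia.
- move=> j lt_j /=; repeat case: ifP => *;
    first [nat_lia | by apply: p_edge; nat_lia | by apply: eit; nat_lia | by apply: et; nat_lia
             | by apply: e0; nat_lia].
- by move=> /=; repeat case: ifP => *; first [by apply: es; nat_lia | nat_lia].
Qed.

Lemma two_zeros_sum (N : nat) (f : nat -> nat) (i j : nat) :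
  i < j -> j < N -> (forall m, m < N -> f m <= 1) -> f i = 0 -> f j = 0 ->
  (\sum_(0 <= m < N) f m).+1 < N.
Proof.
move=> lt_ij lt_jN f_le1 fi0 fj0; rewrite big_mkord.
have i_j : Ordinal lt_jN != Ordinal (ltn_trans lt_ij lt_jN).
  by rewrite -val_eqE /=; nat_lia.
rewrite (bigD1 (Ordinal lt_jN)) //= fj0 (bigD1 (Ordinal (ltn_trans lt_ij lt_jN))) /=;
  last by rewrite eq_sym.
rewrite fi0 !add0n.
set S := bigop _ _ _.
have : S <= \sum_(m < N | (m != Ordinal lt_jN) && (m != Ordinal (ltn_trans lt_ij lt_jN))) 1.
  by apply: leq_sum => m _; apply: f_le1.
have : \sum_(m < N) 1 = N by rewrite sum1_card card_ord.
rewrite (bigD1 (Ordinal lt_jN)) //= (bigD1 (Ordinal (ltn_trans lt_ij lt_jN))) /=;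
  last by rewrite eq_sym.
by move=> sum1_N le_S; rewrite -[X in _ < X]sum1_N !add1n !ltnS.
Qed.

Lemma has_cycle_eq (T : Type) (e : rel T) (m m' : nat) :
  m = m' -> has_cycle e m -> has_cycle e m'.
Proof. by move=> ->. Qed.

(** The cut index is the last neighbour of [p 0] on the path or, in one case, its successor. An edge
    passing over it would close up, together with edges at the two ends of the path, to a cycle of
    length [n] or [n.-1]. *)
Lemma index_cut (T : Type) (e : rel T) (n : nat) (p : nat -> T) :
  symmetric e -> irreflexive e -> 4 <= n -> inj_below n p -> path_edges e n p ->
  ~~ e (p 0) (p n.-1) ->
  n - 2 <= \sum_(0 <= i < n) e (p 0) (p i) + \sum_(0 <= i < n) e (p n.-1) (p i) ->
  ~ has_cycle e n -> ~ has_cycle e n.-1 -> ~ has_cycle e (n - 2) ->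
  exists2 i, 0 < i < n.-1 &
    forall s t, s < i -> i < t < n -> ~~ e (p s) (p t).
Proof.
move=> e_sym e_irr n_ge4 p_inj p_edge nadj deg_sum no_n no_n1 no_n2.
pose a i := e (p 0) (p i); pose b i := e (p n.-1) (p i).
have an : a n.-1 = false by apply: negbTE.
have b0 : b 0 = false by rewrite /b e_sym; apply: negbTE.
have bn : b n.-1 = false by rewrite /b.
have a1 : a 1 by apply: p_edge; nat_lia.
have bn2 : b (n - 2) by apply: p_edge; nat_lia.
(* Otherwise [p 0 .. p t, p n.-1 .. p s] closes up to a cycle of length at
   least [n - 2]. *)
have far s t : s < n -> a s -> b t -> t < s -> t + 4 <= s.
  move=> lt_s as_ bt lt_ts; rewrite leqNgt; apply/negP => close.
  have := @crossing_ends_cycle _ e n s t p e_sym p_inj p_edge _ as_ bt.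
  rewrite lt_ts lt_s => /(_ isT).
  have [s_t|[s_t|s_t]] : s = t.+1 \/ s = t.+2 \/ s = t.+3 by nat_lia.
  - by move=> c; case: no_n; apply: has_cycle_eq c; nat_lia.
  - by move=> c; case: no_n1; apply: has_cycle_eq c; nat_lia.
  - by move=> c; case: no_n2; apply: has_cycle_eq c; nat_lia.
(* By [far] each [f j] is at most 1, so the degree sum leaves room for a single
   zero. *)
pose f j := a j.+1 + b j.
have f_le1 j : j < n.-1 -> f j <= 1.
  rewrite /f => lt_j; case aj: (a _); case bj: (b _) => //.
  by have := far j.+1 j _ aj bj; nat_lia.
have f_sum : n - 2 <= \sum_(0 <= j < n.-1) f j.
  rewrite big_split /=; move: deg_sum.
  have -> : n = n.-1.+1 by nat_lia.
  rewrite big_nat_recl //= e_irr add0n; congr (_ <= _ + _).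
  by rewrite big_nat_recr //= e_irr addn0.
have zero i j : i < j -> j < n.-1 -> f i = 0 -> f j = 0 -> False.
  by move=> lt_ij lt_j fi fj; have := two_zeros_sum lt_ij lt_j f_le1 fi fj; nat_lia.
(* Induction on a bound [d] for [s - t]. For a closest pair with [t < s], minimality excludes [b] at
   [t.+1] and [t.+2], and [far] excludes [a] at [t.+2] and [t.+3], so [f] vanishes at both [t.+1]
   and [t.+2]. *)
have before d s t : s < n -> s <= t + d -> a s -> b t -> s <= t.
  elim: d s t => [|d IH] s t lt_s le_s as_ bt; first nat_lia.
  rewrite leqNgt; apply/negP => lt_ts.
  have s_far := far s t lt_s as_ bt lt_ts.
  have [lt2 lt3 lt4 le1] : [/\ t.+2 < n, t.+3 < n, t.+2 < n.-1 & s <= t.+1 + d].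
    by split; clear -s_far lt_s le_s; nat_lia.
  have [le2 lt_t1s lt_t2s] : [/\ s <= t.+2 + d, t.+1 < s & t.+2 < s].
    by split; clear -s_far lt_s le_s; nat_lia.
  have near r : t < r < t + 4 -> r < n -> a r = false.
    move=> lt_r lt_rn; apply/negP => ar; have := far r t lt_rn ar bt.
    by clear -lt_r; nat_lia.
  have nb1 : b t.+1 = false.
    by apply/negP => /(IH s t.+1 lt_s le1 as_); rewrite leqNgt lt_t1s.
  have nb2 : b t.+2 = false.
    by apply/negP => /(IH s t.+2 lt_s le2 as_); rewrite leqNgt lt_t2s.
  apply: (@zero t.+1 t.+2 _ lt4) => //; rewrite /f near ?nb1 ?nb2 //.
  - by clear; nat_lia.
  - by clear; nat_lia.
have {}before s t : s < n -> a s -> b t -> s <= t.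
  by move=> lt_s; apply: (before s) => //; nat_lia.
have [i lt_i [ai max_i]] : exists2 i, i < n.-1 & a i /\ forall j, j < n -> a j -> j <= i.
  have ex : exists i, (i < n) && a i by exists 1; rewrite a1; nat_lia.
  have bnd i : (i < n) && a i -> i <= n by nat_lia.
  case: (ex_maxnP ex bnd) => i /andP[lt_i ai] max_i; exists i.
    have : i <> n.-1 by move=> ein; move: ai; rewrite ein an.
    nat_lia.
  by split=> // j lt_j aj; apply: max_i; rewrite lt_j aj.

(* [j0] is the only possible zero of [f]; if there is none, the out-of-range value [n] stands in for
   it. *)
have [j0 a_or_b] : exists j0, forall j, j < n.-1 -> j != j0 -> a j.+1 || b j.
  case: (altP (@forallP 'I_n.-1 (fun j => a j.+1 || b j))) => [all_ab|].
    by exists n => j lt_j _; apply: (all_ab (Ordinal lt_j)).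
  rewrite negb_forall => /existsP[j0]; rewrite negb_or => /andP[naj nbj].
  exists (val j0) => j lt_j ne_j; apply: contraT; rewrite negb_or => /andP[naj' nbj'].
  have f0 : f (val j0) = 0 by rewrite /f (negbTE naj) (negbTE nbj).
  have fj : f j = 0 by rewrite /f (negbTE naj') (negbTE nbj').
  have lt_j0 := ltn_ord j0.
  have [lt|lt] : j < val j0 \/ val j0 < j by move: ne_j; clear; nat_lia.
  - by case: (zero _ _ lt lt_j0).
  - by case: (zero _ _ lt lt_j).
have a_full s : s < i -> s != j0 -> a s.+1.
  move=> lt_s ne_s; have := a_or_b s _ ne_s; case: (a _) => //= bs.
  by have := before i s _ ai (bs _); nat_lia.
have b_full t : i <= t -> t < n.-1 -> t != j0 -> b t.
  move=> le_t lt_t ne_t; have := a_or_b t lt_t ne_t; case at1: (a _) => //= _.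
  by have := max_i _ _ at1; nat_lia.
have i_gt0 : 0 < i by apply: (max_i 1) => //; nat_lia.
(* Here [d] counts the vertices skipped in the two gaps from [s] to [s'] and from [t'] to [t]. *)
have long s s' t' t d : s < s' -> s' <= t' -> t' < t < n -> e (p s) (p t) ->
    a s' -> b t' -> s' + t = s + t' + d.+2 -> d <= 1 -> False.
  move=> lt1 le2 lt3 est as' bt' d_def d_le.
  have := crossing_chord_cycle e_sym p_inj p_edge lt1 le2 lt3 est as' bt'.
  have [d0|d1] : d = 0 \/ d = 1 by nat_lia.
  - by move=> c; case: no_n; apply: has_cycle_eq c; nat_lia.
  - by move=> c; case: no_n1; apply: has_cycle_eq c; nat_lia.
(* If [j0] differs from [i], it spoils at most one of [a s.+1] and [b t.-1]; moving that end one
   step further loses a single vertex, which [long] still permits. *)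
have [j0_i|ne_j0] := eqVneq j0 i; last first.
  exists i => [|s t lt_s lt_t]; first nat_lia.
  apply/negP => est; case as1: (a s.+1); last first.
    have s_j0 : s = j0 by apply: contraFeq as1 => ne_s; apply: a_full.
    have s1_i : s.+1 != i by apply: contraFneq as1 => ->.
    apply: (@long s s.+2 t.-1 t 1 _ _ _ est); try (by nat_lia).
    - by apply: a_full; nat_lia.
    - by apply: b_full; nat_lia.
  have [t_j0|ne_t] := eqVneq t.-1 j0.
    apply: (@long s s.+1 (t - 2) t 1 _ _ _ est as1); try (by nat_lia).
    by apply: b_full; nat_lia.
  apply: (@long s s.+1 t.-1 t 0 _ _ _ est as1); try (by nat_lia).
  by apply: b_full; nat_lia.
subst j0.
case bi: (b i).
  exists i => [|s t lt_s lt_t]; first nat_lia.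
  have b_all j : i <= j -> j < n.-1 -> b j.
    by move=> le_j lt_j; have [<-//|ne_j] := eqVneq i j; apply: b_full; nat_lia.
  apply/negP => est.
  apply: (@long s s.+1 t.-1 t 0 _ _ _ est); try (by nat_lia).
  - by apply: a_full; nat_lia.
  - by apply: b_all; nat_lia.
have i_lt : i.+1 < n.-1.
  have : i <> n - 2 by move=> i_n2; move: bi; rewrite i_n2 bn2.
  nat_lia.
have chord s t : s < i -> i.+1 < t < n -> ~~ e (p s) (p t).
  move=> lt_s lt_t; apply/negP => est.
  apply: (@long s s.+1 t.-1 t 0 _ _ _ est); try (by nat_lia).
  - by apply: a_full; nat_lia.
  - by apply: b_full; nat_lia.
(* Only edges at [p i] and [p i.+1] remain undecided. If an earlier vertex is adjacent to [p i.+1],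
   then [two_chords_cycle] forbids edges from [p i] past [i.+1], and [i.+1] is the cut index;
   otherwise it is [i]. *)
case left_i1 : [exists s : 'I_i, e (p s) (p i.+1)].
  have /existsP[[s lt_s] /= es] := left_i1.
  exists i.+1 => [|s' t lt_s' lt_t]; first nat_lia.
  have [lt_s'i|s'_i] : s' < i \/ s' = i by nat_lia.
    by apply: chord; nat_lia.
  apply/negP; rewrite s'_i => eit; apply: no_n.
  apply: (two_chords_cycle e_sym p_inj p_edge lt_s _ eit es).
  - nat_lia.
  - by apply: a_full; nat_lia.
  - by apply: b_full; nat_lia.
exists i => [|s t lt_s lt_t]; first nat_lia.
have [t_i|lt_t'] : t = i.+1 \/ i.+1 < t by nat_lia.
  rewrite t_i; apply: contraFN left_i1 => es.
  by apply/existsP; exists (Ordinal lt_s).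
by apply: chord; nat_lia.
Qed.

(** * Rotating a cycle and inserting vertices *)

Definition cycle_edges (T : Type) (e : rel T) (m : nat) (v : nat -> T) :=
  forall i j, i < m -> j < m ->
    [\/ j = i.+1, i = j.+1, i = m.-1 /\ j = 0 | j = m.-1 /\ i = 0] ->
  e (v i) (v j).

(** The residue of [i] modulo [m] as long as [i < 2 m], a range that covers the sum of two cycle
    indices. *)
Definition cyc_index (m i : nat) := if i < m then i else i - m.

(** An enumeration lists a cycle on the indices below [m] and the vertices off the cycle after it; a
    rotation moves the former and fixes the latter. *)
Definition rotate_first (T : Type) (m r : nat) (v : nat -> T) (i : nat) :=
  if i < m then v (cyc_index m (i + r)) else v i.

Lemma rotate_first_inj (T : Type) (n m r : nat) (v : nat -> T) :
  m <= n -> r < m -> inj_below n v -> inj_below n (rotate_first m r v).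
Proof.
move=> le_mn lt_r v_inj i j lt_i lt_j; rewrite /rotate_first /cyc_index.
by repeat case: ifP => ?; move=> eq_v;
  match goal with H : v ?a = v ?b |- _ => have : a = b; [apply: v_inj => //; nat_lia|nat_lia] end.
Qed.

Lemma rotate_first_edges (T : Type) (e : rel T) (m r : nat) (v : nat -> T) :
  r < m -> cycle_edges e m v -> cycle_edges e m (rotate_first m r v).
Proof.
move=> lt_r v_edge i j lt_i lt_j ij; rewrite /rotate_first /cyc_index lt_i lt_j.
have {}ij : j = i.+1 \/ i = j.+1 \/ (i = m.-1 /\ j = 0) \/ (j = m.-1 /\ i = 0).
  by case: ij; tauto.
apply: v_edge; repeat case: ifP => ?; try nat_lia.
all: have ends a b : a = b.+1 \/ b = a.+1 \/ (a = m.-1 /\ b = 0) \/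
    (b = m.-1 /\ a = 0) ->
    [\/ b = a.+1, a = b.+1, a = m.-1 /\ b = 0 | b = m.-1 /\ a = 0]
  by move=> [?|[?|[?|?]]]; [constructor 2|constructor 1|constructor 3|constructor 4].
all: by apply: ends; nat_lia.
Qed.

Lemma sum_cyc_index_succ (m : nat) (f : nat -> nat) :
  \sum_(0 <= i < m) f (cyc_index m i.+1) = \sum_(0 <= i < m) f i.
Proof.
case: m => [|m]; first by rewrite !big_geq.
rewrite big_nat_recr //= [RHS]big_nat_recl // /cyc_index ltnn subnn addnC.
congr (_ + _); apply: eq_big_nat => i /andP[_ lt_i].
by rewrite ltnS lt_i.
Qed.

Lemma insert_vertex (T : Type) (e : rel T) (n m l z : nat) (v : nat -> T) :
  symmetric e -> inj_below n v -> cycle_edges e m v ->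
  0 < l <= m -> m <= z < n -> e (v z) (v l.-1) -> e (v z) (v 0) ->
  has_cycle e l.+1.
Proof.
move=> e_sym v_inj v_edge lt_l lt_z; rewrite e_sym => /(edge_at e v) el.
move=> /(edge_at e v) e0.
apply: (@reindexed_cycle _ e n _ v (fun i => if i < l then i else z)) => //.
- by cases_lia.
- by cases_lia.
- move=> i lt_i /=; repeat case: ifP => *;
    first [nat_lia | by apply: el; nat_lia | apply: v_edge; try nat_lia].
  by constructor 1.
- by move=> /=; repeat case: ifP => *; first [by apply: e0; nat_lia | nat_lia].
Qed.

(** With [l = m] the cycle grows by both vertices; with [l = m.-1] they replace [v m.-1] and it
    grows by one. *)
Lemma insert_edge (T : Type) (e : rel T) (n m l z z' : nat) (v : nat -> T) :
  symmetric e -> inj_below n v -> cycle_edges e m v ->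
  0 < l <= m -> m <= z < n -> m <= z' < n -> z <> z' -> e (v z) (v z') ->
  e (v z) (v l.-1) -> e (v z') (v 0) -> has_cycle e l.+2.
Proof.
move=> e_sym v_inj v_edge lt_l lt_z lt_z' ne_z /(edge_at e v) ez.
rewrite e_sym => /(edge_at e v) el /(edge_at e v) e0.
apply: (@reindexed_cycle _ e n _ v
  (fun i => if i < l then i else if i == l then z else z')) => //.
- by cases_lia.
- by cases_lia.
- move=> i lt_i /=; repeat case: ifP => *;
    first [nat_lia | by apply: el; nat_lia | by apply: ez; nat_lia
          | apply: v_edge; try nat_lia].
  by constructor 1.
- by move=> /=; repeat case: ifP => *; first [by apply: e0; nat_lia | nat_lia].
Qed.

Lemma cyc_index_lt (m i : nat) : i < m -> cyc_index m i.+1 < m.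
Proof. by rewrite /cyc_index; case: ifP; lia. Qed.

(** Otherwise the cycle, rotated to start at the successor of [v i], could be closed through the
    single vertex [v z] if [z = z'], and through the edge from [v z] to [v z'] if not. *)
Lemma no_consecutive (T : Type) (e : rel T) (n m z z' : nat) (v : nat -> T) :
  symmetric e -> inj_below n v -> cycle_edges e m v -> 0 < m ->
  m <= z < n -> m <= z' < n -> e (v z) (v z') || (z == z') ->
  ~ has_cycle e m.+1 -> (z != z' -> ~ has_cycle e m.+2) ->
  forall i, i < m -> ~~ (e (v z) (v i) && e (v z') (v (cyc_index m i.+1))).
Proof.
move=> e_sym v_inj v_edge m_gt0 lt_z lt_z' ezz' no1 no2 i lt_i.
apply/negP => /andP[ei ej]; have lt_w := cyc_index_lt lt_i.
have le_mn : m <= n by nat_lia.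
have w_inj := rotate_first_inj le_mn lt_w v_inj.
have w_edge := rotate_first_edges lt_w v_edge.
set w := rotate_first _ _ _ in w_inj w_edge.
have wE y : m <= y -> w y = v y by rewrite /w /rotate_first => ?; case: ifP => // ?; nat_lia.
have w0 : w 0 = v (cyc_index m i.+1).
  by rewrite /w /rotate_first m_gt0 /cyc_index; congr v; repeat case: ifP; nat_lia.
have wm : w m.-1 = v i.
  rewrite /w /rotate_first; case: ifP => ?; last nat_lia.
  by congr v; rewrite /cyc_index; repeat case: ifP; nat_lia.
have [zz'|ne_z] := eqVneq z z'.
  apply: no1; apply: (@insert_vertex _ e n m m z w) => //; first nat_lia.
  - by rewrite wm wE //; nat_lia.
  - by rewrite w0 wE ?zz' //; nat_lia.
apply: (no2 ne_z); apply: (@insert_edge _ e n m m z z' w) => //.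
- nat_lia.
- by apply/eqP.
- by rewrite !wE; [rewrite (negbTE ne_z) orbF in ezz'| nat_lia | nat_lia].
- by rewrite wm wE //; nat_lia.
- by rewrite w0 wE //; nat_lia.
Qed.

(** Otherwise the adjacent vertices [v z] and [v z'] could replace the one cycle vertex between
    [v i] and its second successor. *)
Lemma no_distance_two (T : Type) (e : rel T) (n m z z' : nat) (v : nat -> T) :
  symmetric e -> inj_below n v -> cycle_edges e m v -> 1 < m ->
  m <= z < n -> m <= z' < n -> e (v z) (v z') -> z != z' ->
  ~ has_cycle e m.+1 ->
  forall i, i < m ->
    ~~ (e (v z) (v i) && e (v z') (v (cyc_index m (cyc_index m i.+1).+1))).
Proof.
move=> e_sym v_inj v_edge m_gt1 lt_z lt_z' ezz' ne_z no1 i lt_i.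
apply/negP => /andP[ei ej]; have lt_w := cyc_index_lt (cyc_index_lt lt_i).
have le_mn : m <= n by nat_lia.
have w_inj := rotate_first_inj le_mn lt_w v_inj.
have w_edge := rotate_first_edges lt_w v_edge.
set w := rotate_first _ _ _ in w_inj w_edge.
have wE y : m <= y -> w y = v y by rewrite /w /rotate_first => ?; case: ifP => // ?; nat_lia.
have w0 : w 0 = v (cyc_index m (cyc_index m i.+1).+1).
  by rewrite /w /rotate_first ltnW // add0n {1}/cyc_index lt_w.
have wm : w m.-2 = v i.
  rewrite /w /rotate_first; case: ifP => ?; last nat_lia.
  by congr v; rewrite /cyc_index; repeat case: ifP; nat_lia.
apply: no1; have -> : m = m.-1.+1 by nat_lia.
apply: (@insert_edge _ e n m m.-1 z z' w) => //.
- nat_lia.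
- by apply/eqP.
- by rewrite !wE //; nat_lia.
- by rewrite wm wE //; nat_lia.
- by rewrite w0 wE //; nat_lia.
Qed.

(** * Index sets without consecutive elements *)

Lemma sparse_sum (a : pred nat) (L : nat) :
  (forall i, i.+1 < L -> ~~ (a i && a i.+1)) ->
  \sum_(0 <= i < L) a i <= uphalf L.
Proof.
elim/ltn_ind: L => -[|[|L]] IH a_sparse; first by rewrite big_geq.
  by rewrite big_nat1; case: (a 0).
rewrite !big_nat_recr //=.
have /IH : L < L.+2 by [].
have := a_sparse L (ltnSn _).
move=> H /(_ (fun i lt_i => a_sparse i (ltnW (ltnW lt_i)))).
by move: H; case: (a L); case: (a L.+1) => //= _; lia.
Qed.

(** This is the equality case of [sparse_sum] in odd length. The last two positions contribute at
    most one element, so the initial stretch is extremal too and ends in an element, which pushes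
    the remaining one to the very end. *)
Lemma sparse_sum_max (a : pred nat) (r : nat) :
  (forall i, i.+1 < r.*2.+1 -> ~~ (a i && a i.+1)) ->
  r < \sum_(0 <= i < r.*2.+1) a i ->
  forall i, i < r.*2.+1 -> a i = ~~ odd i.
Proof.
elim: r => [|r IH] a_sparse.
  by rewrite big_nat1 => a0 [|//] _; case: (a 0) a0.
rewrite doubleS !big_nat_recr //= => sum_a.
have sp L : L <= r.*2.+3 -> \sum_(0 <= i < L) a i <= uphalf L.
  by move=> le_L; apply: sparse_sum => i lt_i; apply: a_sparse; lia.
have := a_sparse r.*2.+1; rewrite ltnSn => /(_ isT) sp1.
have even_a : forall i, i < r.*2.+1 -> a i = ~~ odd i.
  apply: IH => [i lt_i|]; first by apply: a_sparse; lia.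
  have := sp r.*2.+1 _; move: sum_a sp1; rewrite big_nat_recr //=.
  by case: (a r.*2.+1); case: (a r.*2.+2) => //= sum_a _; lia.
have a2r := even_a _ (ltnSn _); rewrite odd_double in a2r.
have := a_sparse r.*2 _; rewrite a2r doubleS => na1; have {}na1 : ~~ a r.*2.+1 by apply: na1; lia.
have a2 : a r.*2.+2.
  have := sp r.*2.+1 _; move: sum_a; rewrite (negbTE na1) big_nat_recr //=.
  by case: (a r.*2.+2) => //; lia.
move=> i lt_i; have [lt|[->|->]] : i < r.*2.+1 \/ i = r.*2.+1 \/ i = r.*2.+2 by lia.
- exact: even_a.
- by rewrite (negbTE na1) /= odd_double.
- by rewrite a2 /= odd_double.
Qed.

(** * Cycles missing at most two vertices *)

Definition near_independent_set (T : finType) (e : rel T) (m : nat) :=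
  exists (I : {set T}) (a b : T),
    [/\ #|I| = m, [/\ a \in I, b \in I & a != b]
      & {in I &, forall u w, e u w ->
          (u == a) && (w == b) || (u == b) && (w == a)}].

Lemma near_independent_seq (T : finType) (e : rel T) (m : nat) (q : nat -> T) :
  symmetric e -> irreflexive e -> 0 < m -> inj_below m.+1 q ->
  (forall i j, i < j <= m -> e (q i) (q j) -> i = m.-1 /\ j = m) ->
  near_independent_set e m.+1.
Proof.
move=> e_sym e_irr m_gt0 q_inj q_edge.
have q_ord_inj : injective (fun i : 'I_m.+1 => q i).
  by move=> i j /(q_inj _ _ (ltn_ord i) (ltn_ord j)) /val_inj.
exists [set q i | i : 'I_m.+1], (q m.-1), (q m); split.
- by rewrite card_imset // card_ord.
- split.
  + have lt_m : m.-1 < m.+1 by lia.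
    by apply/imsetP; exists (Ordinal lt_m).
  + by apply/imsetP; exists ord_max.
  + by apply/eqP => /q_inj; lia.
move=> u w /imsetP[i _ ->] /imsetP[j _ ->] eij.
have lt_i := ltn_ord i; have lt_j := ltn_ord j.
have [lt_ij|[lt_ji|eq_ij]] : i < j \/ j < i \/ i = j :> nat by lia.
- have /(_ eij) : e (q i) (q j) -> i = m.-1 :> nat /\ j = m :> nat.
    by apply: q_edge; lia.
  by case=> -> ->; rewrite !eqxx.
- rewrite e_sym in eij; have /(_ eij) : e (q j) (q i) -> j = m.-1 :> nat /\ i = m :> nat.
    by apply: q_edge; lia.
  by case=> -> ->; rewrite !eqxx orbT.
- by rewrite (val_inj eq_ij) e_irr in eij.
Qed.

Definition all_degrees_ge (T : finType) (e : rel T) (d : nat) :=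
  forall u, d <= #|[set w | e u w]|.

Lemma enumeration_sum (T : finType) (n : nat) (v : nat -> T) (P : pred T) :
  #|T| = n -> inj_below n v -> #|[set w | P w]| = \sum_(0 <= i < n) P (v i).
Proof.
move=> card_T v_inj; rewrite -sum1_card big_mkord.
have v_ord_inj : injective (fun i : 'I_n => v i).
  by move=> i j /(v_inj _ _ (ltn_ord i) (ltn_ord j)) /val_inj.
have v_bij : bijective (fun i : 'I_n => v i).
  by apply: inj_card_bij => //; rewrite card_T card_ord.
rewrite (reindex (fun i : 'I_n => v i)) /=; last exact: onW_bij.
under eq_bigl do rewrite inE.
by rewrite big_mkcond /=; apply: eq_bigr => i _; case: (P _).
Qed.

(** The route is: down from [v i.-1] to [v 0], across to [v m.-1], down to [v j], across to [v i],
    up to [v j.-1], back through [v z]. It serves to show that successors of neighbours of [v z] are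
    non-adjacent. *)
Lemma insert_between_predecessors (T : Type) (e : rel T) (n m z i j : nat)
    (v : nat -> T) :
  symmetric e -> inj_below n v -> cycle_edges e m v -> m <= z < n ->
  0 < i -> i < j < m -> e (v z) (v i.-1) -> e (v z) (v j.-1) ->
  e (v i) (v j) -> has_cycle e m.+1.
Proof.
move=> e_sym v_inj v_edge lt_z i_gt0 lt_ij /(edge_at e v) ei.
rewrite e_sym => /(edge_at e v) ej; rewrite e_sym => /(edge_at e v) eij.
apply: (@reindexed_cycle _ e n _ v
  (fun t => if t < i then i.-1 - t else
            if t < i + (m - j) then m.-1 - (t - i) else
            if t < m then i + (t - (i + (m - j))) else z)) => //.
- by cases_lia.
- by cases_lia.
- move=> t lt_t /=; repeat case: ifP => *;
    first [nat_lia | by apply: ej; nat_lia | by apply: eij; nat_lia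
    | by apply: v_edge; first [nat_lia | constructor 1; nat_lia
        | constructor 2; nat_lia | constructor 4; nat_lia]].
- by move=> /=; repeat case: ifP => *; first [by apply: ei; nat_lia | nat_lia].
Qed.

(** The mirror image, for the predecessors [v i] of [v i.+1] and [v m.-1] of [v 0]: up from [v 0] to
    [v i], across to [v m.-1], down to [v i.+1], back through [v z]. *)
Lemma insert_between_successors (T : Type) (e : rel T) (n m z i : nat)
    (v : nat -> T) :
  symmetric e -> inj_below n v -> cycle_edges e m v -> m <= z < n ->
  i.+1 < m -> e (v z) (v i.+1) -> e (v z) (v 0) ->
  e (v i) (v m.-1) -> has_cycle e m.+1.
Proof.
move=> e_sym v_inj v_edge lt_z lt_i; rewrite e_sym => /(edge_at e v) ei.
move=> /(edge_at e v) e0 /(edge_at e v) eim.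
apply: (@reindexed_cycle _ e n _ v
  (fun t => if t <= i then t else
            if t < m then m.-1 - (t - i.+1) else z)) => //.
- by cases_lia.
- by cases_lia.
- move=> t lt_t /=; repeat case: ifP => *;
    first [nat_lia | by apply: ei; nat_lia | by apply: eim; nat_lia
    | by apply: v_edge; first [nat_lia | constructor 1; nat_lia
        | constructor 2; nat_lia]].
- by move=> /=; repeat case: ifP => *; first [by apply: e0; nat_lia | nat_lia].
Qed.

Lemma alternating_parity (a : pred nat) (m : nat) :
  (forall i, i.+1 < m -> a i.+1 = ~~ a i) ->
  forall i, i < m -> a i = a 0 (+) odd i.
Proof.
move=> alt; elim=> [|i IH] lt_i; first by rewrite addbF.
by rewrite alt // IH ?(ltnW lt_i) //= addbN.
Qed.

(* The vertex off the cycle has [k - 1] pairwise non-consecutive neighbours on a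
   cycle of length [2k - 1], so they alternate except for one gap of length 3,
   rotated here to the end. Their successors, or else their predecessors, are
   independent. *)
Lemma near_spanning_cycle_normalized (T : finType) (e : rel T) (k m : nat)
    (v : nat -> T) :
  symmetric e -> irreflexive e -> 2 < k -> m.+1 = k.*2 -> #|T| = m.+1 ->
  all_degrees_ge e k.-1 -> inj_below m.+1 v -> cycle_edges e m v ->
  ~ has_cycle e m.+1 ->
  ~~ e (v m) (v (m - 2)) -> ~~ e (v m) (v m.-1) ->
  near_independent_set e k.+1.
Proof.
move=> e_sym e_irr k_gt2 m_def card_T deg v_inj v_edge no_n nx2 nx1.
pose a i := e (v m) (v i).
(* Without [v (m - 2)] and [v m.-1], the [k.-1] neighbours of [v m] lie among
   [m - 2 = (k - 2).*2.+1] indices, which is the extremal case with [r = k - 2]. *)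
have a_even : forall i, i < (k - 2).*2.+1 -> a i = ~~ odd i.
  apply: sparse_sum_max => [i lt_i|].
    have lt_im : i < m by nat_lia.
    have no2 : m != m -> ~ has_cycle e m.+2 by rewrite eqxx.
    have := no_consecutive e_sym v_inj v_edge (z := m) (z' := m) _ _ _ _ no_n no2 lt_im.
    rewrite eqxx orbT leqnn ltnSn /cyc_index ifT; last by nat_lia.
    by apply=> //; nat_lia.
  have := deg (v m); rewrite (enumeration_sum _ card_T v_inj).
  have m3 : m.+1 = (k - 2).*2.+1.+3 by nat_lia.
  rewrite m3 !big_nat_recr //=.
  have -> : (k - 2).*2.+3 = m by nat_lia.
  have -> : (k - 2).*2.+2 = m.-1 by nat_lia.
  have -> : (k - 2).*2.+1 = m - 2 by nat_lia.
  by rewrite e_irr (negbTE nx1) (negbTE nx2) /a; lia.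
have even_adj i : ~~ odd i -> i < m - 2 -> e (v m) (v i).
  by move=> ev_i lt_i; have := a_even i; rewrite /a ev_i => -> //; nat_lia.
have odd_adj i : odd i -> i < m - 2 -> ~~ e (v m) (v i).
  by move=> ev_i lt_i; have := a_even i; rewrite /a ev_i => -> //; nat_lia.
have odd_odd i j : odd i -> odd j -> i < j < m -> ~~ e (v i) (v j).
  move=> odd_i odd_j lt_ij; apply/negP => eij; apply: no_n.
  by apply: (insert_between_predecessors e_sym v_inj v_edge (z := m) _ _ lt_ij _ _ eij);
    first [apply: even_adj; lia | lia].
have odd_last i : odd i -> i < m - 2 -> ~~ e (v i) (v m.-1).
  move=> odd_i lt_i; apply/negP => eij; apply: no_n.
  by apply: (insert_between_successors e_sym v_inj v_edge (z := m) _ _ _ _ eij);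
    first [apply: even_adj; lia | lia].
(* The set consists of [v m], the vertices of odd index [1, 3, .., m - 2], and [v m.-1]. The
   permitted edge joins the last two, which are consecutive on the cycle. *)
apply: (@near_independent_seq _ e k (fun i =>
  if i == 0 then v m else if i == k then v m.-1 else v i.*2.-1)) => //.
- by nat_lia.
- move=> i j lt_i lt_j; repeat case: ifP => ?; move=> eq_v;
    first [nat_lia | match type of eq_v with v ?a = v ?b =>
      have : a = b; [by apply: v_inj => //; nat_lia | nat_lia] end].
- have odd_pred i : i != 0 -> odd i.*2.-1 by move=> ?; lia.
  move=> i j lt_ij; repeat case: ifP => ?; move=> eij; try nat_lia.
  + by rewrite eij in nx1.
  + have odd_j : odd j.*2.-1 by apply: odd_pred; nat_lia.
    have [j_m|lt_j] : j.*2.-1 = m - 2 \/ j.*2.-1 < m - 2 by nat_lia.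
      by rewrite j_m (negbTE nx2) in eij.
    by rewrite (negbTE (odd_adj _ odd_j lt_j)) in eij.
  + have odd_i : odd i.*2.-1 by apply: odd_pred; nat_lia.
    have [i_k|lt_i] : i = k.-1 \/ i.*2.-1 < m - 2 by nat_lia.
      by split=> //; nat_lia.
    by rewrite (negbTE (odd_last _ odd_i lt_i)) in eij.
  + have odd_i : odd i.*2.-1 by apply: odd_pred; nat_lia.
    have odd_j : odd j.*2.-1 by apply: odd_pred; nat_lia.
    have lt_ij2 : i.*2.-1 < j.*2.-1 < m by nat_lia.
    by rewrite (negbTE (odd_odd _ _ odd_i odd_j lt_ij2)) in eij.
Qed.

Lemma rotate_first_out (T : Type) (m r i : nat) (v : nat -> T) :
  m <= i -> rotate_first m r v i = v i.
Proof. by rewrite /rotate_first ltnNge => ->. Qed.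

(** As [m] is odd, the neighbours of [v m] cannot alternate all around the cycle, so some two
    consecutive cycle vertices are non-neighbours; a rotation moves them to the indices [m - 2] and
    [m.-1]. *)
Lemma near_spanning_cycle (T : finType) (e : rel T) (k m : nat)
    (v : nat -> T) :
  symmetric e -> irreflexive e -> 2 < k -> m.+1 = k.*2 -> #|T| = m.+1 ->
  all_degrees_ge e k.-1 -> inj_below m.+1 v -> cycle_edges e m v ->
  ~ has_cycle e m.+1 -> near_independent_set e k.+1.
Proof.
move=> e_sym e_irr k_gt2 m_def card_T deg v_inj v_edge no_n.
have cons i : i < m -> ~~ (e (v m) (v i) && e (v m) (v (cyc_index m i.+1))).
  apply: (no_consecutive e_sym v_inj v_edge (z := m) (z' := m)) => //;
    first [nat_lia | by rewrite eqxx ?orbT].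
have [i lt_i [/negbTE nei /negbTE nej]] : exists2 i, i < m &
    ~~ e (v m) (v i) /\ ~~ e (v m) (v (cyc_index m i.+1)).
  case gap: [exists i : 'I_m,
      ~~ e (v m) (v i) && ~~ e (v m) (v (cyc_index m i.+1))].
    have /existsP[[i lt_i] /= /andP[]] := gap.
    by exists i.
  have alt i : i < m -> e (v m) (v (cyc_index m i.+1)) = ~~ e (v m) (v i).
    move=> lt_i; have := cons i lt_i.
    have := negbT gap; rewrite negb_exists => /forallP /(_ (Ordinal lt_i)) /=.
    by case: (e _ (v i)); case: (e _ _).
  have par : forall i, i < m -> e (v m) (v i) = e (v m) (v 0) (+) odd i.
    apply: alternating_parity => i lt_im.
    by rewrite -alt /cyc_index ?lt_im // ltnW.
  have lt_m : m.-1 < m by nat_lia.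
  have := alt m.-1 lt_m; rewrite (par _ lt_m).
  have -> : cyc_index m m.-1.+1 = 0 by rewrite /cyc_index; case: ifP; nat_lia.
  have -> : odd m.-1 = false by clear -m_def k_gt2; lia.
  by rewrite addbF; case: (e _ _).
have lt_w := cyc_index_lt (cyc_index_lt lt_i).
set r := cyc_index m (cyc_index m i.+1).+1 in lt_w.
have w_inj := rotate_first_inj (leqnSn m) lt_w v_inj.
have w_edge := rotate_first_edges lt_w v_edge.
apply: (near_spanning_cycle_normalized e_sym e_irr k_gt2 m_def card_T deg w_inj
  w_edge no_n); rewrite rotate_first_out //.
- suff -> : rotate_first m r v (m - 2) = v i by rewrite nei.
  rewrite /rotate_first ifT; last nat_lia.
  by congr v; rewrite /r /cyc_index; repeat case: ifP; nat_lia.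
- suff -> : rotate_first m r v m.-1 = v (cyc_index m i.+1) by rewrite nej.
  rewrite /rotate_first ifT; last nat_lia.
  by congr v; rewrite /r /cyc_index; repeat case: ifP; nat_lia.
Qed.

(** * Two vertices off the cycle *)

(** The route is [v 0], [v 1], [v z'], then from [v m.-1] down to [v 2], and back through [v z]. *)
Lemma opposite_insertions_cycle (T : Type) (e : rel T) (n m z z' : nat)
    (v : nat -> T) :
  symmetric e -> inj_below n v -> cycle_edges e m v -> 2 < m ->
  m <= z < n -> m <= z' < n -> z <> z' ->
  e (v z) (v 0) -> e (v z) (v 2) -> e (v z') (v 1) -> e (v z') (v m.-1) ->
  has_cycle e m.+2.
Proof.
move=> e_sym v_inj v_edge m_gt2 lt_z lt_z' ne_z /(edge_at e v) ez0.
rewrite e_sym => /(edge_at e v) ez2; rewrite e_sym => /(edge_at e v) ez'1.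
move=> /(edge_at e v) ez'm.
apply: (@reindexed_cycle _ e n _ v
  (fun t => if t < 2 then t else if t == 2 then z' else
            if t < m.+1 then m.-1 - (t - 3) else z)) => //.
- by cases_lia.
- by cases_lia.
- move=> t lt_t /=; repeat case: ifP => *;
    first [nat_lia | by apply: ez2; nat_lia | by apply: ez'1; nat_lia
    | by apply: ez'm; nat_lia
    | by apply: v_edge; first [nat_lia | constructor 1; nat_lia
        | constructor 2; nat_lia]].
- by move=> /=; repeat case: ifP => *; first [by apply: ez0; nat_lia | nat_lia].
Qed.

(** At least [k.-1] pairwise non-consecutive neighbours of [v z] lie on a cycle of length
    [2 (k - 1)], which leaves no room for two consecutive non-neighbours. *)
Lemma outside_alternating (T : finType) (e : rel T) (k m z : nat)
    (v : nat -> T) :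
  symmetric e -> irreflexive e -> 3 < k -> m.+2 = k.*2 -> #|T| = m.+2 ->
  all_degrees_ge e k.-1 -> inj_below m.+2 v -> cycle_edges e m v ->
  ~ has_cycle e m.+1 -> m <= z < m.+2 -> ~~ e (v m) (v m.+1) ->
  forall i, i < m -> e (v z) (v (cyc_index m i.+1)) = ~~ e (v z) (v i).
Proof.
move=> e_sym e_irr k_gt3 m_def card_T deg v_inj v_edge no1 lt_z nadj i lt_i.
have cons j : j < m -> ~~ (e (v z) (v j) && e (v z) (v (cyc_index m j.+1))).
  apply: (no_consecutive e_sym v_inj v_edge (z := z) (z' := z)) => //;
    first [nat_lia | by rewrite eqxx ?orbT].
have := cons i lt_i; case ej: (e _ (v (cyc_index _ _))); case ei: (e _ (v i)) => //= _.
(* Rotating by [r] puts two consecutive non-neighbours last; the other [m - 2] positions hold at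
   most [k - 2] neighbours. *)
have lt_w := cyc_index_lt (cyc_index_lt lt_i).
set r := cyc_index m (cyc_index m i.+1).+1 in lt_w.
have w_inj := rotate_first_inj (leqW (leqnSn m)) lt_w v_inj.
have w_edge := rotate_first_edges lt_w v_edge.
set w := rotate_first m r v in w_inj w_edge.
have wz : w z = v z by rewrite /w rotate_first_out //; nat_lia.
have w2 : w (m - 2) = v i.
  rewrite /w /rotate_first ifT; last nat_lia.
  by congr v; rewrite /r /cyc_index; repeat case: ifP; nat_lia.
have w1 : w m.-1 = v (cyc_index m i.+1).
  rewrite /w /rotate_first ifT; last nat_lia.
  by congr v; rewrite /r /cyc_index; repeat case: ifP; nat_lia.
have sparse : \sum_(0 <= j < m - 2) e (v z) (w j) <= uphalf (m - 2).
  apply: sparse_sum => j lt_j; rewrite -wz.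
  have lt_jm : j < m by nat_lia.
  have := no_consecutive e_sym w_inj w_edge (z := z) (z' := z) _ _ _ _ no1 _ lt_jm.
  rewrite eqxx orbT lt_z /cyc_index ifT; last by nat_lia.
  by apply=> //; nat_lia.
have := deg (v z); rewrite (enumeration_sum _ card_T w_inj).
have -> : m.+2 = (m - 2).+4 by nat_lia.
rewrite !big_nat_recr //=.
have -> : (m - 2).+3 = m.+1 by nat_lia.
have -> : (m - 2).+2 = m by nat_lia.
have -> : (m - 2).+1 = m.-1 by nat_lia.
have wm1 : w m.+1 = v m.+1 by rewrite /w rotate_first_out.
have wm : w m = v m by rewrite /w rotate_first_out.
rewrite w1 w2 ei ej wm wm1.
have -> : e (v z) (v m) = false.
  have [->|->] : z = m \/ z = m.+1 by nat_lia.
    by rewrite e_irr.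
  by rewrite e_sym; apply: negbTE.
have -> : e (v z) (v m.+1) = false.
  have [->|->] : z = m \/ z = m.+1 by nat_lia.
    exact: negbTE.
  by rewrite e_irr.
by clear -sparse m_def k_gt3; lia.
Qed.

(** Each outside vertex sees every other cycle vertex. In opposite phase both can be inserted at
    once; in equal phase they form, with the [k.-1] cycle vertices of odd index, an independent
    set. *)
Lemma two_outside_nonadjacent_normalized (T : finType) (e : rel T) (k m : nat)
    (v : nat -> T) :
  symmetric e -> irreflexive e -> 3 < k -> m.+2 = k.*2 -> #|T| = m.+2 ->
  all_degrees_ge e k.-1 -> inj_below m.+2 v -> cycle_edges e m v ->
  ~ has_cycle e m.+1 -> ~ has_cycle e m.+2 -> ~~ e (v m) (v m.+1) ->
  e (v m) (v 0) -> near_independent_set e k.+1.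
Proof.
move=> e_sym e_irr k_gt3 m_def card_T deg v_inj v_edge no1 no2 nadj ex0.
have par z : m <= z < m.+2 ->
    forall i, i < m -> e (v z) (v i) = e (v z) (v 0) (+) odd i.
  move=> lt_z; apply: alternating_parity => i lt_i.
  rewrite -(outside_alternating e_sym e_irr k_gt3 m_def card_T deg v_inj v_edge) //.
    by rewrite /cyc_index lt_i.
  exact: ltnW.
have x_adj i : i < m -> e (v m) (v i) = ~~ odd i.
  by move=> lt_i; rewrite (par m) // ?ex0 // leqnn leqnSn.
have y_adj i : i < m -> e (v m.+1) (v i) = e (v m.+1) (v 0) (+) odd i.
  by move=> lt_i; rewrite (par m.+1) // leqnSn ltnSn.
case ey0: (e (v m.+1) (v 0)) y_adj => y_adj; last first.
  have odd_m : odd m.-1 by clear -m_def k_gt3; lia.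
  case: no2; apply: (@opposite_insertions_cycle _ e m.+2 m m m.+1 v) => //;
    first [nat_lia | by rewrite x_adj; nat_lia | by rewrite y_adj ?odd_m; nat_lia].
have odd_odd i j : odd i -> odd j -> i < j < m -> ~~ e (v i) (v j).
  move=> odd_i odd_j lt_ij; apply/negP => eij; apply: no1.
  apply: (insert_between_predecessors e_sym v_inj v_edge (z := m) _ _ lt_ij _ _ eij).
  - by rewrite leqnn leqnSn.
  - by clear -odd_i; lia.
  - by rewrite x_adj; clear -odd_i lt_ij; lia.
  - by rewrite x_adj; clear -odd_j lt_ij; lia.
apply: (@near_independent_seq _ e k (fun i =>
  if i == k then v m.+1 else if i == k.-1 then v m else v i.*2.+1)) => //.
- by nat_lia.
- move=> i j lt_i lt_j; repeat case: ifP => ?; move=> eq_v;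
    first [nat_lia | match type of eq_v with v ?a = v ?b =>
      have : a = b; [by apply: v_inj => //; nat_lia | nat_lia] end].
- have odd_succ i : odd i.*2.+1 by lia.
  move=> i j lt_ij; repeat case: ifP => ?; move=> eij;
    first [nat_lia
    | by rewrite (negbTE nadj) in eij
    | by move: eij; rewrite e_sym y_adj ?odd_succ //; nat_lia
    | by move: eij; rewrite e_sym x_adj ?odd_succ //; nat_lia
    | idtac].
  have lt_ij2 : i.*2.+1 < j.*2.+1 < m by nat_lia.
  by rewrite (negbTE (odd_odd _ _ _ _ lt_ij2)) in eij.
Qed.

Lemma two_outside_nonadjacent (T : finType) (e : rel T) (k m : nat)
    (v : nat -> T) :
  symmetric e -> irreflexive e -> 3 < k -> m.+2 = k.*2 -> #|T| = m.+2 ->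
  all_degrees_ge e k.-1 -> inj_below m.+2 v -> cycle_edges e m v ->
  ~ has_cycle e m.+1 -> ~ has_cycle e m.+2 -> ~~ e (v m) (v m.+1) ->
  near_independent_set e k.+1.
Proof.
move=> e_sym e_irr k_gt3 m_def card_T deg v_inj v_edge no1 no2 nadj.
case ex0: (e (v m) (v 0)).
  exact: (two_outside_nonadjacent_normalized e_sym e_irr k_gt3 m_def card_T
    deg v_inj v_edge).
have lt1m : 1 < m by nat_lia.
have w_inj := rotate_first_inj (leqW (leqnSn m)) lt1m v_inj.
have w_edge := rotate_first_edges lt1m v_edge.
apply: (two_outside_nonadjacent_normalized e_sym e_irr k_gt3 m_def card_T
  deg w_inj w_edge) => //.
  by rewrite !rotate_first_out.
rewrite rotate_first_out // /rotate_first ltnW // add0n.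
have lt_m : m <= m < m.+2 by rewrite leqnn leqnSn.
have := outside_alternating e_sym e_irr k_gt3 m_def card_T deg v_inj v_edge no1
  lt_m nadj (ltnW lt1m).
by rewrite ex0 /cyc_index lt1m.
Qed.

(* With [c] counting the cycle vertices adjacent to [v m] or to [v m.+1] and
   [d] those adjacent to both, the neighbours, their successors, and the second
   successors of the common neighbours are disjoint: [2 c + d <= m]. *)
Lemma two_outside_common (T : finType) (e : rel T) (k m : nat) (v : nat -> T) :
  symmetric e -> irreflexive e -> 3 < k -> m.+2 = k.*2 -> #|T| = m.+2 ->
  all_degrees_ge e k.-1 -> inj_below m.+2 v -> cycle_edges e m v ->
  ~ has_cycle e m.+1 -> ~ has_cycle e m.+2 -> e (v m) (v m.+1) ->
  k = 4 /\ exists2 i, i < m & e (v m) (v i) && e (v m.+1) (v i).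
Proof.
move=> e_sym e_irr k_gt3 m_def card_T deg v_inj v_edge no1 no2 exy.
pose s i := cyc_index m i.+1.
pose c i : nat := e (v m) (v i) || e (v m.+1) (v i).
pose d i : nat := e (v m) (v i) && e (v m.+1) (v i).
have lt_x : m <= m < m.+2 by nat_lia.
have lt_y : m <= m.+1 < m.+2 by nat_lia.
have m_gt1 : 1 < m by nat_lia.
have ne_xy : m != m.+1 by nat_lia.
have eyx : e (v m.+1) (v m) by rewrite e_sym.
have cons z z' i : m <= z < m.+2 -> m <= z' < m.+2 -> i < m ->
    ~~ (e (v z) (v i) && e (v z') (v (s i))).
  move=> lt_z lt_z' lt_i.
  apply: (no_consecutive e_sym v_inj v_edge (z := z) (z' := z')) => //;
    first nat_lia.
  have [[-> ->]|[[-> ->]|->]] : (z = m /\ z' = m.+1) \/ (z = m.+1 /\ z' = m) \/ z = z'.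
    by nat_lia.
  - by rewrite exy.
  - by rewrite eyx.
  - by rewrite eqxx orbT.
have disj i : i < m -> c (s (s i)) + c (s i) + d i <= 1.
  move=> lt_i; have lt_s := cyc_index_lt lt_i.
  have := cons m m i lt_x lt_x lt_i; have := cons m m.+1 i lt_x lt_y lt_i.
  have := cons m.+1 m.+1 i lt_y lt_y lt_i.
  have := cons m m _ lt_x lt_x lt_s; have := cons m m.+1 _ lt_x lt_y lt_s.
  have := cons m.+1 m _ lt_y lt_x lt_s; have := cons m.+1 m.+1 _ lt_y lt_y lt_s.
  have := no_distance_two e_sym v_inj v_edge m_gt1 lt_x lt_y exy ne_xy no1 lt_i.
  have := no_distance_two e_sym v_inj v_edge m_gt1 lt_y lt_x eyx
    (introN eqP (nesym (elimN eqP ne_xy))) no1 lt_i.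
  rewrite -/(s i) -/(s (s i)) /c /d.
  by do 6! case: (e _ _).
have sum_c : \sum_(0 <= i < m) c (s i) = \sum_(0 <= i < m) c i.
  exact: sum_cyc_index_succ.
have sum_c2 : \sum_(0 <= i < m) c (s (s i)) = \sum_(0 <= i < m) c i.
  by rewrite -sum_c -(sum_cyc_index_succ m (fun i => c (s i))).
have sum_le : (\sum_(0 <= i < m) c i).*2 + \sum_(0 <= i < m) d i <= m.
  rewrite -addnn -{1}sum_c2 -{1}sum_c -!big_split /=.
  apply: leq_trans (_ : \sum_(0 <= i < m) 1 <= _); last first.
    by rewrite sum_nat_const_nat subn0 muln1.
  by rewrite !big_mkord; apply: leq_sum => i _; apply: disj.
have le_dc : \sum_(0 <= i < m) d i <= \sum_(0 <= i < m) c i.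
  by apply: leq_sum => i _; rewrite /c /d; do 2! case: (e _ _).
have sum_cd : \sum_(0 <= i < m) c i + \sum_(0 <= i < m) d i =
    \sum_(0 <= i < m) e (v m) (v i) + \sum_(0 <= i < m) e (v m.+1) (v i).
  by rewrite -!big_split /=; apply: eq_bigr => i _; rewrite /c /d; do 2! case: (e _ _).
have := deg (v m); rewrite (enumeration_sum _ card_T v_inj) !big_nat_recr //=.
rewrite e_irr exy; have := deg (v m.+1).
rewrite (enumeration_sum _ card_T v_inj) !big_nat_recr //= e_irr eyx => deg_y deg_x.
(* Write [C] and [D] for the sums of [c] and [d]. The degrees give [C + D >= 2 (k - 2)]; with
   [2 C + D <= 2 (k - 1)] this yields [C <= 2], and [D <= C] then yields [k <= 4]. For [k = 4] it
   follows that [D >= 2]. *)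
have k4 : k = 4.
  by move: deg_x deg_y sum_cd le_dc sum_le; clear -m_def k_gt3; lia.
have sum_d : 0 < \sum_(0 <= i < m) d i.
  by move: deg_x deg_y sum_cd le_dc sum_le; clear -m_def k4; lia.
split=> //; case ex: [exists i : 'I_m, e (v m) (v i) && e (v m.+1) (v i)].
  by have /existsP[[i lt_i] /= ei] := ex; exists i.
move: sum_d; rewrite big_mkord big1 // => i _; rewrite /d.
by have := negbT ex; rewrite negb_exists => /forallP /(_ i) /negbTE ->.
Qed.

(* Unlike in F2 itself, x_1 and x_4 (indices 0 and 3) may be adjacent, and all
   edges are optional. *)
Definition F2_shaped (T : finType) (e : rel T) :=
  exists f : 'I_8 -> T, injective f /\
    forall i j, e (f i) (f j) ->
      F2_adj i j || (val i \in [:: 0; 3]) && (val j \in [:: 0; 3]).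

Lemma listed_cycle (T : Type) (e : rel T) (v : nat -> T) (l : seq nat) :
  inj_below 8 v -> size l = 8 -> uniq l -> all (gtn 8) l ->
  (forall i, i.+1 < 8 -> e (v (nth 0 l i)) (v (nth 0 l i.+1))) ->
  e (v (nth 0 l 7)) (v (nth 0 l 0)) -> has_cycle e 8.
Proof.
move=> v_inj size_l uniq_l /all_nthP lt_l l_edge l_close.
apply: (reindexed_cycle v_inj (g := nth 0 l)) => //.
- by move=> i lt_i; apply: lt_l; rewrite size_l.
- by move=> i j lt_i lt_j /eqP; rewrite nth_uniq ?size_l // => /eqP.
Qed.

(** The enumeration is already the labelling of [F2]: the hubs are [v 0] and [v 3], and the three
    pairs have indices 1 and 2, 4 and 5, 6 and 7. The degrees make [v 3] a second common neighbour
    of [v 6] and [v 7]; edges between different pairs would then give a Hamiltonian cycle or a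
    vertex of degree 2. *)
Lemma two_triples_F2 (T : finType) (e : rel T) (v : nat -> T) :
  symmetric e -> irreflexive e -> #|T| = 8 -> all_degrees_ge e 3 ->
  inj_below 8 v -> cycle_edges e 6 v -> ~ has_cycle e 7 -> ~ has_cycle e 8 ->
  e (v 6) (v 7) -> e (v 6) (v 0) -> e (v 7) (v 0) -> F2_shaped e.
Proof.
move=> e_sym e_irr card_T deg v_inj v_edge no1 no2 e67 e60 e70.
have cons z z' i : 6 <= z < 8 -> 6 <= z' < 8 -> i < 6 ->
    ~~ (e (v z) (v i) && e (v z') (v (cyc_index 6 i.+1))).
  move=> lt_z lt_z' lt_i.
  apply: (no_consecutive e_sym v_inj v_edge (z := z) (z' := z')) => //.
  have [[-> ->]|[[-> ->]|->]] : (z = 6 /\ z' = 7) \/ (z = 7 /\ z' = 6) \/ z = z'.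
    by nat_lia.
  - by rewrite e67.
  - by rewrite e_sym e67.
  - by rewrite eqxx orbT.
have e76 : e (v 7) (v 6) by rewrite e_sym.
have dist := no_distance_two e_sym v_inj v_edge (isT : 1 < 6) _ _ _ _ no1.
have not_adj i : 0 < i < 6 -> i != 3 -> ~~ e (v 6) (v i) /\ ~~ e (v 7) (v i).
  move=> lt_i ne_i.
  have [->|[->|[->|->]]] : i = 1 \/ i = 2 \/ i = 4 \/ i = 5 by nat_lia.
  - have := cons 6 7 0 isT isT isT; have := cons 7 6 0 isT isT isT.
    by rewrite e60 e70 /=.
  - have := @dist 6 7 isT isT e67 isT 0 isT; have := @dist 7 6 isT isT e76 isT 0 isT.
    by rewrite e60 e70 /=.
  - have := @dist 6 7 isT isT e67 isT 4 isT; have := @dist 7 6 isT isT e76 isT 4 isT.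
    by rewrite /= e60 e70 /= !andbT.
  - have := cons 6 7 5 isT isT isT; have := cons 7 6 5 isT isT isT.
    by rewrite /= e60 e70 /= !andbT.
have [n61 n71] := not_adj 1 isT isT.
have [n62 n72] := not_adj 2 isT isT.
have [n64 n74] := not_adj 4 isT isT.
have [n65 n75] := not_adj 5 isT isT.
have sumE u : 3 <= \sum_(0 <= i < 8) e u (v i).
  by rewrite -(enumeration_sum _ card_T v_inj); apply: deg.
have e63 : e (v 6) (v 3).
  have := sumE (v 6); rewrite !big_nat_recr //= big_geq // e_irr.
  rewrite (negbTE n61) (negbTE n62) (negbTE n64) (negbTE n65).
  by case: (e _ (v 3)) => //; do 2!case: (e _ _).
have e73 : e (v 7) (v 3).
  have := sumE (v 7); rewrite !big_nat_recr //= big_geq // e_irr.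
  rewrite (negbTE n71) (negbTE n72) (negbTE n74) (negbTE n75).
  by case: (e _ (v 3)) => //; do 2!case: (e _ _).
have e01 : e (v 0) (v 1) by apply: v_edge => //; constructor 1.
have e12 : e (v 1) (v 2) by apply: v_edge => //; constructor 1.
have e23 : e (v 2) (v 3) by apply: v_edge => //; constructor 1.
have e34 : e (v 3) (v 4) by apply: v_edge => //; constructor 1.
have e45 : e (v 4) (v 5) by apply: v_edge => //; constructor 1.
have e50 : e (v 5) (v 0) by apply: v_edge => //; constructor 3.
have list_cycle l : size l = 8 -> uniq l -> all (gtn 8) l ->
    [&& e (v (nth 0 l 0)) (v (nth 0 l 1)), e (v (nth 0 l 1)) (v (nth 0 l 2)),
        e (v (nth 0 l 2)) (v (nth 0 l 3)), e (v (nth 0 l 3)) (v (nth 0 l 4)),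
        e (v (nth 0 l 4)) (v (nth 0 l 5)), e (v (nth 0 l 5)) (v (nth 0 l 6)),
        e (v (nth 0 l 6)) (v (nth 0 l 7)) & e (v (nth 0 l 7)) (v (nth 0 l 0))]
    -> False.
  move=> size_l uniq_l lt_l /and5P[h0 h1 h2 h3 /and4P[h4 h5 h6 h7]].
  apply: no2; apply: (listed_cycle v_inj size_l uniq_l lt_l) => //.
  by do 7![case=> //].
have sy i j : e (v i) (v j) -> e (v j) (v i) by rewrite e_sym.
have n14 : ~~ e (v 1) (v 4).
  apply/negP => h; apply: (list_cycle [:: 1; 4; 5; 0; 6; 7; 3; 2]) => //=.
  by rewrite h e45 e50 (sy 6 0) // e67 e73 (sy 2 3) // (sy 1 2).
have n25 : ~~ e (v 2) (v 5).
  apply/negP => h; apply: (list_cycle [:: 2; 5; 4; 3; 6; 7; 0; 1]) => //=.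
  by rewrite h (sy 4 5) // (sy 3 4) // (sy 6 3) // e67 e70 e01 e12.
(* Such an edge would leave [v 4] only the neighbours [v 3] and [v 5]. *)
have n15 : ~~ e (v 1) (v 5).
  apply/negP => h.
  have n40 : ~~ e (v 4) (v 0).
    apply/negP => h'; apply: (list_cycle [:: 0; 6; 7; 3; 2; 1; 5; 4]) => //=.
    by rewrite (sy 6 0) // e67 e73 (sy 2 3) // (sy 1 2) // h (sy 4 5) // h'.
  have n42 : ~~ e (v 4) (v 2).
    apply/negP => h'; apply: (list_cycle [:: 0; 6; 7; 3; 4; 2; 1; 5]) => //=.
    by rewrite (sy 6 0) // e67 e73 e34 h' (sy 1 2) // h e50.
  have := sumE (v 4); rewrite !big_nat_recr //= big_geq // e_irr.
  rewrite (negbTE n40) (negbTE n42) (e_sym _ (v 1)) (negbTE n14).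
  rewrite (e_sym _ (v 6)) (negbTE n64) (e_sym _ (v 7)) (negbTE n74).
  by do 2!case: (e _ _).
(* Such an edge would leave [v 5] only the neighbours [v 0] and [v 4]. *)
have n24 : ~~ e (v 2) (v 4).
  apply/negP => h.
  have n53 : ~~ e (v 5) (v 3).
    apply/negP => h'; apply: (list_cycle [:: 3; 6; 7; 0; 1; 2; 4; 5]) => //=.
    by rewrite (sy 6 3) // e67 e70 e01 e12 h e45 h'.
  have := sumE (v 5); rewrite !big_nat_recr //= big_geq // e_irr.
  rewrite (negbTE n53) (e_sym _ (v 1)) (negbTE n15) (e_sym _ (v 2)) (negbTE n25).
  rewrite (e_sym _ (v 6)) (negbTE n65) (e_sym _ (v 7)) (negbTE n75).
  by do 2!case: (e _ _).
have sn i j : ~~ e (v i) (v j) -> e (v j) (v i) = false.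
  by rewrite e_sym => /negbTE.
exists (fun i : 'I_8 => v i); split.
  by move=> i j /(v_inj _ _ (ltn_ord i) (ltn_ord j)) /val_inj.
case=> i lt_i [j lt_j] /=.
case: i lt_i => [|[|[|[|[|[|[|[|i]]]]]]]] lt_i //;
  case: j lt_j => [|[|[|[|[|[|[|[|j]]]]]]]] lt_j //;
  rewrite ?e_irr ?(negbTE n61) ?(negbTE n62) ?(negbTE n64) ?(negbTE n65)
    ?(negbTE n71) ?(negbTE n72) ?(negbTE n74) ?(negbTE n75) ?(negbTE n14)
    ?(negbTE n25) ?(negbTE n15) ?(negbTE n24)
    ?(sn _ _ n61) ?(sn _ _ n62) ?(sn _ _ n64) ?(sn _ _ n65)
    ?(sn _ _ n71) ?(sn _ _ n72) ?(sn _ _ n74) ?(sn _ _ n75) ?(sn _ _ n14)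
    ?(sn _ _ n25) ?(sn _ _ n15) ?(sn _ _ n24) //.
Qed.

Lemma near_spanning_cycle2 (T : finType) (e : rel T) (k m : nat) (v : nat -> T) :
  symmetric e -> irreflexive e -> 3 < k -> m.+2 = k.*2 -> #|T| = m.+2 ->
  all_degrees_ge e k.-1 -> inj_below m.+2 v -> cycle_edges e m v ->
  ~ has_cycle e m.+1 -> ~ has_cycle e m.+2 ->
  near_independent_set e k.+1 \/ k = 4 /\ F2_shaped e.
Proof.
move=> e_sym e_irr k_gt3 m_def card_T deg v_inj v_edge no1 no2.
case exy: (e (v m) (v m.+1)); last first.
  left; apply: (two_outside_nonadjacent e_sym e_irr k_gt3 m_def card_T deg
    v_inj v_edge) => //.
  by rewrite exy.
have [k4 [i lt_i /andP[exi eyi]]] := two_outside_common e_sym e_irr k_gt3 m_def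
  card_T deg v_inj v_edge no1 no2 exy.
right; split=> //.
have w_inj := rotate_first_inj (leqW (leqnSn m)) lt_i v_inj.
have w_edge := rotate_first_edges lt_i v_edge.
have m6 : m = 6 by nat_lia.
subst k m; apply: (two_triples_F2 e_sym e_irr card_T deg w_inj w_edge) => //.
all: by rewrite /rotate_first /= /cyc_index lt_i.
Qed.

(** * Obstructions to Hamiltonicity *)

(** Applied once or twice, this gives the vertices missed by a cycle the indices that follow it. *)
Lemma extend_enumeration (T : finType) (m : nat) (v : nat -> T) :
  m < #|T| -> inj_below m v ->
  exists2 w, inj_below m.+1 w & forall i, i < m -> w i = v i.
Proof.
move=> lt_m v_inj.
have [x x_new] : exists x, x \notin [seq v i | i <- iota 0 m].
  apply/existsP; rewrite -negb_forall; apply: contraL lt_m => /forallP all_v.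
  have <- : size [seq v i | i <- iota 0 m] = m by rewrite size_map size_iota.
  rewrite -leqNgt; apply: leq_trans (card_size _).
  by apply/subset_leq_card/subsetP => y _; apply: all_v.
have ne_x i : i < m -> v i <> x.
  by move=> lt_i eq_x; case/mapP: x_new; exists i; rewrite ?mem_iota.
exists (fun i => if i < m then v i else x) => [i j lt_i lt_j|i ->//].
case: ifP => lt_im; case: ifP => lt_jm.
- exact: v_inj.
- by move/(ne_x _ lt_im).
- by move/esym/(ne_x _ lt_jm).
- by nat_lia.
Qed.

Lemma has_cycle_enumeration (T : Type) (e : rel T) (m : nat) :
  symmetric e -> has_cycle e m ->
  exists2 v, inj_below m v & cycle_edges e m v.
Proof.
move=> e_sym [v [v_inj v_edge v_close]]; exists v => // i j lt_i lt_j.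
case=> [j_i|i_j|[-> ->]|[-> ->]] //.
- by rewrite j_i; apply: v_edge; rewrite -j_i.
- by rewrite e_sym i_j; apply: v_edge; rewrite -i_j.
- by rewrite e_sym.
Qed.

Lemma cycle_edges_eq (T : Type) (e : rel T) (m : nat) (v w : nat -> T) :
  (forall i, i < m -> w i = v i) -> cycle_edges e m v -> cycle_edges e m w.
Proof. by move=> w_v v_edge i j lt_i lt_j; rewrite !w_v //; apply: v_edge. Qed.

(** [A] is a union of components of the graph without [c]; the graph itself may be disconnected. *)
Definition has_cut_vertex (T : finType) (e : rel T) :=
  exists (c : T) (A : {set T}),
    [/\ c \notin A, exists a, a \in A, exists b, b \notin c |: A
      & forall a b, a \in A -> b \notin c |: A -> ~~ e a b].

Definition add_edge (T : eqType) (e : rel T) (a b : T) : rel T :=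
  fun u w => [|| e u w, (u == a) && (w == b) | (u == b) && (w == a)].

Lemma add_edge_sym (T : eqType) (e : rel T) (a b : T) :
  symmetric e -> symmetric (add_edge e a b).
Proof.
move=> e_sym u w; rewrite /add_edge e_sym; congr (_ || _).
by rewrite orbC !(andbC (w == _)).
Qed.

(** Some step of the cycle is not an edge of [e], hence is the added edge; rotating the cycle so
    that it becomes the closing step leaves a path in [e]. *)
Lemma hamiltonian_path_without (T : eqType) (e : rel T) (a b : T) (n : nat) :
  symmetric e -> 2 < n -> has_cycle (add_edge e a b) n -> ~ has_cycle e n ->
  exists p, [/\ inj_below n p, path_edges e n p & ~~ e (p 0) (p n.-1)].
Proof.
move=> e_sym n_gt2.
move=> /(has_cycle_enumeration (add_edge_sym a b e_sym))[v v_inj v_edge] no_n.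
have [i lt_i nei] : exists2 i, i < n & ~~ e (v i) (v (cyc_index n i.+1)).
  case ex: [exists i : 'I_n, ~~ e (v i) (v (cyc_index n i.+1))].
    by have /existsP[[i lt_i] /= nei] := ex; exists i.
  have all_e i : i < n -> e (v i) (v (cyc_index n i.+1)).
    move=> lt_i; have := negbT ex; rewrite negb_exists.
    by move=> /forallP /(_ (Ordinal lt_i)); rewrite negbK.
  case: no_n; exists v; split=> // [i lt_i|].
    by have := all_e i (ltnW lt_i); rewrite /cyc_index lt_i.
  have lt_n : n.-1 < n by nat_lia.
  by have := all_e _ lt_n; rewrite /cyc_index prednK ?ltnn ?subnn //; nat_lia.
have lt_r := cyc_index_lt lt_i.
have p_inj := rotate_first_inj (leqnn n) lt_r v_inj.
have p_edge := rotate_first_edges lt_r v_edge.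
set p := rotate_first _ _ _ in p_inj p_edge.
have n_gt0 : 0 < n by nat_lia.
have lt_n1 : n.-1 < n by nat_lia.
have p0 : p 0 = v (cyc_index n i.+1).
  by rewrite /p /rotate_first n_gt0 add0n /cyc_index; congr v; repeat case: ifP; nat_lia.
have pn : p n.-1 = v i.
  by rewrite /p /rotate_first lt_n1 /cyc_index; congr v; repeat case: ifP; nat_lia.
have nep : ~~ e (p 0) (p n.-1) by rewrite p0 pn e_sym.
exists p; split=> // j l lt_j lt_l jl.
have : add_edge e a b (p j) (p l).
  by apply: p_edge => //; case: jl; [constructor 1 | constructor 2].
have : add_edge e a b (p n.-1) (p 0) by apply: p_edge => //; constructor 3.
(* The closing step already joins [a] and [b]; a path step with the same ends would contradict
   injectivity. *)
rewrite {1}/add_edge e_sym (negbTE nep) /= => p_ab.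
case/or3P => // /andP[/eqP pj /eqP pl]; case/orP: p_ab => /andP[/eqP pna /eqP p0b].
- have := p_inj j n.-1 lt_j lt_n1; rewrite pj pna => /(_ erefl) j_n.
  have := p_inj l 0 lt_l n_gt0; rewrite pl p0b => /(_ erefl) l_0.
  by nat_lia.
- have := p_inj j 0 lt_j n_gt0; rewrite pj p0b => /(_ erefl) j_0.
  have := p_inj l n.-1 lt_l lt_n1; rewrite pl pna => /(_ erefl) l_n.
  by nat_lia.
- have := p_inj j 0 lt_j n_gt0; rewrite pj p0b => /(_ erefl) j_0.
  have := p_inj l n.-1 lt_l lt_n1; rewrite pl pna => /(_ erefl) l_n.
  by nat_lia.
- have := p_inj j n.-1 lt_j lt_n1; rewrite pj pna => /(_ erefl) j_n.
  have := p_inj l 0 lt_l n_gt0; rewrite pl p0b => /(_ erefl) l_0.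
  by nat_lia.
Qed.

Lemma index_cut_vertex (T : finType) (e : rel T) (n i : nat) (p : nat -> T) :
  #|T| = n -> inj_below n p -> 0 < i < n.-1 ->
  (forall s t, s < i -> i < t < n -> ~~ e (p s) (p t)) -> has_cut_vertex e.
Proof.
move=> card_T p_inj lt_i no_edge.
have p_ord_inj : injective (fun j : 'I_n => p j).
  by move=> j l /(p_inj _ _ (ltn_ord j) (ltn_ord l)) /val_inj.
have [g _ gK] : bijective (fun j : 'I_n => p j).
  by apply: inj_card_bij => //; rewrite card_T card_ord.
have in_A s : s < n -> (p s \in [set p (val j) | j : 'I_n & j < i]) = (s < i).
  move=> lt_s; apply/imsetP/idP => [[j]|lt_si].
    by rewrite inE => lt_j /(p_inj _ _ lt_s (ltn_ord j)) ->.
  by exists (Ordinal lt_s); rewrite ?inE.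
exists (p i), [set p (val j) | j : 'I_n & j < i]; split.
- by rewrite in_A ?ltnn //; nat_lia.
- by exists (p 0); rewrite in_A; nat_lia.
- exists (p n.-1); rewrite !inE in_A; last nat_lia.
  by apply/norP; split; [apply/eqP => /p_inj; nat_lia | nat_lia].
- move=> a b /imsetP[s]; rewrite inE => lt_s -> {a}.
  have [j ->] : exists j : 'I_n, b = p j by exists (g b); rewrite gK.
  have lt_j := ltn_ord j.
  rewrite !inE in_A // negb_or => /andP[ne_b not_lt]; apply: no_edge => //.
  have : val j <> i by move=> ji; rewrite -ji eqxx in ne_b.
  by move=> /= ?; nat_lia.
Qed.

Theorem nonhamiltonian_obstruction (T : finType) (e : rel T) (k : nat) :
  symmetric e -> irreflexive e -> 3 < k -> #|T| = k.*2 ->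
  all_degrees_ge e k.-1 -> ~ has_cycle e k.*2 ->
  [\/ has_cut_vertex e, near_independent_set e k.+1 | k = 4 /\ F2_shaped e].
Proof.
move=> + + k_gt3 card_T.
move: {2}#|_| (leqnn #|[set q : T * T | ~~ e q.1 q.2]|) => N.
elim: N e => [|N IH] e le_N e_sym e_irr deg no_n.
  (* Diagonal pairs count as non-edges, so the count cannot be 0. *)
  have [x _] : exists x : T, x \in T by apply/card_gt0P; rewrite card_T; nat_lia.
  by move: le_N; rewrite leqn0 => /eqP/cards0_eq/setP/(_ (x, x)); rewrite !inE e_irr.
case ex: [exists q : T * T, (q.1 != q.2) && ~~ e q.1 q.2]; last first.
  have all_e u w : u != w -> e u w.
    have := negbT ex; rewrite negb_exists => /forallP /(_ (u, w)) /=.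
    by case: (u == w) => //=; rewrite negbK.
  have x0 : T by have /card_gt0P/sigW[x _] : 0 < #|T| by rewrite card_T; nat_lia.
  case: no_n; exists (nth x0 (enum T)).
  have nth_inj i j : i < k.*2 -> j < k.*2 ->
      (nth x0 (enum T) i == nth x0 (enum T) j) = (i == j).
    by move=> lt_i lt_j; rewrite nth_uniq ?enum_uniq // -cardE card_T.
  split=> [i j lt_i lt_j /eqP|i lt_i|].
  - by rewrite nth_inj // => /eqP.
  - by apply: all_e; rewrite nth_inj //; nat_lia.
  - by apply: all_e; rewrite nth_inj //; nat_lia.
have /existsP[[a b] /= /andP[ne_ab neab]] := ex.
pose e' := add_edge e a b.
have e'_sym : symmetric e' := add_edge_sym a b e_sym.
have e'_irr : irreflexive e'.
  move=> u; rewrite /e' /add_edge e_irr /=; have [->|] := eqVneq u a => //=.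
    by rewrite (negbTE ne_ab).
  by rewrite andbF.
have sub_e u w : e u w -> e' u w by rewrite /e' /add_edge => ->.
have deg' : all_degrees_ge e' k.-1.
  move=> u; apply: leq_trans (deg u) _; apply/subset_leq_card/subsetP => w.
  by rewrite !inE; apply: sub_e.
have lt_N : #|[set q : T * T | ~~ e' q.1 q.2]| <= N.
  rewrite -ltnS; apply: leq_trans le_N; apply: proper_card.
  apply/properP; split.
    by apply/subsetP => q; rewrite !inE; apply: contra; apply: sub_e.
  by exists (a, b); rewrite !inE //= /e' /add_edge !eqxx orbT.
have [ham'|nonham'] := classic (has_cycle e' k.*2); last first.
  have [cut|ind|[k4 F2_e']] := IH e' lt_N e'_sym e'_irr deg' nonham'.
  - case: cut => c [A [cA A_ne B_ne no_e']]; constructor 1; exists c, A; split=> //.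
    by move=> u w uA wA; apply: contra (no_e' u w uA wA); apply: sub_e.
  - case: ind => I [c [d [card_I I_cd I_edge]]]; constructor 2; exists I, c, d.
    by split=> // u w uI wI /sub_e; apply: I_edge.
  - case: F2_e' => f [f_inj f_edge]; constructor 3; split=> //; exists f.
    by split=> // i j /sub_e; apply: f_edge.
have n_gt2 : 2 < k.*2 by nat_lia.
have [p [p_inj p_edge nadj]] := hamiltonian_path_without e_sym n_gt2 ham' no_n.
have [[v v_inj v_edge]|no_n1] : (exists2 v, inj_below k.*2.-1 v & cycle_edges e k.*2.-1 v) \/
    ~ has_cycle e k.*2.-1.
  have [c|nc] := classic (has_cycle e k.*2.-1); [left | by right].
  exact: has_cycle_enumeration.
- have k2 : k.*2.-1.+1 = k.*2 by nat_lia.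
  have [|w w_inj w_v] := extend_enumeration _ v_inj; first by rewrite card_T; nat_lia.
  constructor 2; apply: (@near_spanning_cycle _ e k k.*2.-1 w) => //.
  + by nat_lia.
  + by rewrite k2.
  + exact: cycle_edges_eq w_v v_edge.
  + by rewrite k2.
have [[v v_inj v_edge]|no_n2] : (exists2 v, inj_below (k.*2 - 2) v & cycle_edges e (k.*2 - 2) v) \/
    ~ has_cycle e (k.*2 - 2).
  have [c|nc] := classic (has_cycle e (k.*2 - 2)); [left | by right].
  exact: has_cycle_enumeration.
- have k2 : (k.*2 - 2).+2 = k.*2 by nat_lia.
  have k1 : (k.*2 - 2).+1 = k.*2.-1 by nat_lia.
  have [|w w_inj w_v] := extend_enumeration _ v_inj; first by rewrite card_T; nat_lia.
  have [|x x_inj x_w] := extend_enumeration _ w_inj; first by rewrite card_T; nat_lia.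
  have x_v i : i < k.*2 - 2 -> x i = v i by move=> lt_i; rewrite x_w ?w_v // leqW.
  case: (@near_spanning_cycle2 _ e k (k.*2 - 2) x) => //; rewrite ?k2 ?k1 //.
  + exact: cycle_edges_eq x_v v_edge.
  + by constructor 2.
  + by constructor 3.
have [i lt_i no_edge] : exists2 i, 0 < i < k.*2.-1 &
    forall s t, s < i -> i < t < k.*2 -> ~~ e (p s) (p t).
  apply: index_cut => //; first by nat_lia.
  rewrite -!(enumeration_sum _ card_T p_inj).
  by have := deg (p 0); have := deg (p k.*2.-1); clear -k_gt3; lia.
by constructor 1; apply: index_cut_vertex card_T p_inj lt_i no_edge.
Qed.

(** * The families *)

Lemma path_map_iota (T : Type) (e : rel T) (v : nat -> T) (j m : nat) :
  (forall i, j <= i < j + m -> e (v i) (v i.+1)) ->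
  path e (v j) [seq v i | i <- iota j.+1 m] /\
  last (v j) [seq v i | i <- iota j.+1 m] = v (j + m).
Proof.
elim: m j => [|m IH] j v_edge /=; first by rewrite addn0.
have [i lt_i|-> ->] := IH j.+1; first by apply: v_edge; nat_lia.
by rewrite addSnnS v_edge //; nat_lia.
Qed.

Lemma has_cycle_hamiltonian (G : sgraph) (n : nat) :
  2 < n -> #|G| = n -> has_cycle (@adj G) n -> hamiltonian G.
Proof.
move=> n_gt2 card_G [v [v_inj v_edge v_close]].
have uniq_c : uniq [seq v i | i <- iota 0 n].
  rewrite map_inj_in_uniq ?iota_uniq // => i j.
  by rewrite !mem_iota => lt_i lt_j; apply: v_inj.
exists [seq v i | i <- iota 0 n]; split.
- by rewrite size_map size_iota.
- rewrite /ucycle uniq_c andbT.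
  case: n n_gt2 {card_G v_inj uniq_c} v_edge v_close => // n n_gt2 v_edge v_close.
  have [i lt_i|path_v last_v] := @path_map_iota _ (@adj G) v 0 n.
    by apply: v_edge; nat_lia.
  by rewrite /= rcons_path path_v last_v.
- move=> u; have /subset_cardP : #|[seq v i | i <- iota 0 n]| = #|G|.
    by rewrite (card_uniqP uniq_c) size_map size_iota.
  by move=> /(_ (subset_predT _)) ->.
Qed.

Lemma partition_mate (T : finType) (P : {set {set T}}) :
  partition P [set: T] -> {in P, forall A : {set T}, #|A| = 2} ->
  exists mu : T -> T,
    [/\ involutive mu, forall u, mu u != u & P = [set [set u; mu u] | u : T]].
Proof.
move=> P_part P_card; have /and3P[/eqP P_cover P_triv _] := P_part.
have cov u : u \in cover P by rewrite P_cover.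
(* The default [u] never occurs: a part of size 2 has a second element. *)
pose mu u := odflt u [pick w in pblock P u :\ u].
have block u : pblock P u = [set u; mu u] /\ mu u != u.
  have := P_card _ (pblock_mem (cov u)); rewrite (cardsD1 u) mem_pblock cov.
  move=> [/eqP/cards1P[w eq_w]].
  have mu_w : mu u = w.
    rewrite /mu; case: pickP => [w'|/(_ w)]; rewrite eq_w inE ?eqxx //.
    by move=> /eqP.
  split; last by have := set11 w; rewrite -eq_w !inE mu_w => /andP[].
  by rewrite mu_w -eq_w setD1K // mem_pblock.
exists mu; split=> [u|u|].
- have [block_u mu_u] := block u; have [block_mu mu_mu] := block (mu u).
  have eq_block : pblock P (mu u) = pblock P u.
    by apply: same_pblock => //; rewrite block_u !inE eqxx orbT.
  have : mu (mu u) \in pblock P u by rewrite -eq_block block_mu !inE eqxx orbT.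
  by rewrite block_u !inE (negbTE mu_mu) orbF => /eqP.
- by have [] := block u.
- apply/setP => A; apply/idP/imsetP => [PA|[u _ ->]].
    have /card_gt0P[u uA] : 0 < #|A| by rewrite P_card.
    by exists u => //; rewrite -(block u).1; apply/esym/def_pblock.
  by rewrite -(block u).1 pblock_mem.
Qed.

(** Removing one orbit at a time collects a representative of each. The even cardinality serves in
    parity arguments, the representatives in labelling the parts. *)
Lemma involution_half (T : finType) (mu : T -> T) (A : {set T}) :
  involutive mu -> (forall u, mu u != u) -> (forall u, u \in A -> mu u \in A) ->
  exists2 s : seq T, #|A| = (size s).*2 &
    forall w, (w \in A) = (w \in s) || (mu w \in s).
Proof.
move=> muK mu_neq; have [n] := ubnP #|A|; elim: n A => // n IH A lt_n A_mu.
have [->|[u uA]] := set_0Vmem A.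
  by exists [::]; rewrite ?cards0 // => w; rewrite !inE.
have [] := IH (A :\ u :\ mu u).
- by move: lt_n; rewrite (cardsD1 u) (cardsD1 (mu u)) uA; lia.
- move=> w; rewrite !inE => /and3P[w_mu w_u wA].
  by rewrite (inj_eq (inv_inj muK)) w_u (inv_eq muK) w_mu A_mu.
move=> s card_s s_mem; exists (u :: s).
  by rewrite (cardsD1 u) (cardsD1 (mu u)) uA !inE mu_neq A_mu //= card_s; lia.
move=> w; rewrite !inE.
have [->|w_u] := eqVneq w u; first by rewrite uA.
have [->|w_mu] := eqVneq w (mu u); first by rewrite A_mu // muK eqxx orbT.
have := s_mem w; rewrite !inE w_u w_mu /= => ->.
by rewrite (inv_eq muK) (negbTE w_mu).
Qed.

Lemma set_enumeration (T : finType) (A : {set T}) (n : nat) :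
  #|A| = n -> exists2 x : 'I_n -> T, injective x & forall u, (u \in A) = (u \in codom x).
Proof.
move=> <-; exists (@enum_val _ (mem A)); first exact: enum_val_inj.
move=> u; apply/idP/codomP => [uA|[i ->]]; last exact: enum_valP.
by exists (enum_rank_in uA u); rewrite enum_rankK_in.
Qed.

(** * Cut vertices and the first family *)

(** Vertices of [A] have all their neighbours in [c |: A], so the degrees force this set to have
    exactly [k] vertices and to be a clique; it provides the [x i], with [c] as [x l], and their
    partners fill the complement. The partner of [c] must see the whole rest of the complement,
    while any other [y i] can miss at most one of its [k] candidates. *)
Lemma cut_vertex_F1_ordered (G : sgraph) (k : nat) (P : {set {set G}})
    (mu : G -> G) (c : G) (A : {set G}) :
  0 < k -> #|G| = k.*2 -> balanced_partite k P -> all_degrees_ge (@adj G) k.-1 ->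
  involutive mu -> (forall u, mu u != u) -> (forall u, ~~ adj u (mu u)) ->
  P = [set [set u; mu u] | u : G] ->
  c \notin A -> (exists a, a \in A) -> (exists b, b \notin c |: A) ->
  (forall a b, a \in A -> b \notin c |: A -> ~~ adj a b) ->
  #|A| < k -> family_F1 k P.
Proof.
move=> k_gt0 card_G P_bal deg muK mu_neq mu_nadj P_def cA [a0 a0A] [b0 b0A] no_edge lt_A.
have nbr_A a : a \in A -> [set w | adj a w] \subset (c |: A) :\ a.
  move=> aA; apply/subsetP => w; rewrite inE => aw; rewrite in_setD1.
  have -> : w != a by apply: contraTneq aw => ->; rewrite adj_irrefl.
  by apply: contraLR aw; apply: no_edge.
have card_cA : #|c |: A| = #|A|.+1 by rewrite cardsU1 cA.
have card_A : #|c |: A| = k.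
  have := leq_trans (deg a0) (subset_leq_card (nbr_A _ a0A)).
  by have := cardsD1 a0 (c |: A); rewrite card_cA inE a0A orbT; lia.
have A_adj a w : a \in A -> w \in c |: A -> w != a -> adj a w.
  move=> aA wA w_a; have /eqP nbr_eq : [set w | adj a w] == (c |: A) :\ a.
    rewrite eqEcard nbr_A //=; apply: leq_trans (deg a).
    by have := cardsD1 a (c |: A); rewrite card_A inE aA orbT; lia.
  by have : w \in [set w | adj a w] by [rewrite nbr_eq in_setD1 w_a]; rewrite inE.
have clique u w : u \in c |: A -> w \in c |: A -> u != w -> adj u w.
  move=> uA wA u_w; have := uA; rewrite 2!inE => /orP[/eqP u_c|uA'].
    have := wA; rewrite 2!inE => /orP[/eqP w_c|wA']; first by rewrite u_c w_c eqxx in u_w.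
    by rewrite adj_sym; apply: A_adj.
  by apply: A_adj; rewrite // eq_sym.
have [x x_inj x_mem] := set_enumeration card_A.
have x_in i : x i \in c |: A by rewrite x_mem codom_f.
pose y i := mu (x i).
have y_inj : injective y by move=> i j /(inv_inj muK)/x_inj.
have y_out i : y i \notin c |: A.
  by apply: contra (mu_nadj (x i)) => yA; apply: clique; rewrite // eq_sym.
have y_mem u : (u \notin c |: A) = (u \in codom y).
  have -> : codom y =i [set y i | i : 'I_k].
    by move=> w; apply/codomP/imsetP => [[i ->]|[i _ ->]]; exists i.
  have /eqP -> : [set y i | i : 'I_k] == ~: (c |: A); last by rewrite in_setC.
  rewrite eqEcard card_imset // card_ord; apply/andP; split.
    by apply/subsetP => _ /imsetP[i _ ->]; rewrite in_setC.
  by have := cardsC (c |: A); rewrite card_A card_G; lia.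
have card_B : #|~: (c |: A)| = k.
  by have := cardsC (c |: A); rewrite card_A card_G; lia.
have [l xl] : exists l, x l = c.
  by have := setU11 c A; rewrite x_mem => /codomP[l ->]; exists l.
have nbr_B b : b \notin c |: A -> [set w | adj b w] \subset c |: (~: (c |: A) :\ b).
  move=> bB; apply/subsetP => w; rewrite inE => bw; rewrite in_setU1 in_setD1 in_setC.
  have -> /= : w != b by apply: contraTneq bw => ->; rewrite adj_irrefl.
  rewrite orbC -implyNb negbK; apply/implyP; rewrite in_setU1 => /orP[//|wA].
  by rewrite adj_sym (negbTE (no_edge _ _ wA bB)) in bw.
split=> //; exists x, y, l; split.
- rewrite P_def; apply/setP => B; apply/imsetP/imsetP => [[u _ ->]|[i _ ->]]; last by exists (x i).
  have [uA|] := boolP (u \in c |: A).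
    by move: uA; rewrite x_mem => /codomP[i ->]; exists i.
  by rewrite y_mem => /codomP[i ->]; exists i => //; rewrite /y muK setUC.
- by move=> i j ne_ij; apply: clique; rewrite // (inj_eq x_inj).
- move=> i ne_il.
  have sub_l : [set w | adj (y l) w] \subset ~: (c |: A) :\ y l.
    apply/subsetP => w wl; have := subsetP (nbr_B _ (y_out l)) _ wl.
    rewrite in_setU1 => /orP[/eqP w_c|//]; move: wl.
    by rewrite w_c inE adj_sym -xl (negbTE (mu_nadj _)).
  have /eqP nbr_eq : [set w | adj (y l) w] == ~: (c |: A) :\ y l.
    rewrite eqEcard sub_l /=; apply: leq_trans (deg _).
    by have := cardsD1 (y l) (~: (c |: A)); rewrite card_B in_setC y_out; lia.
  have : y i \in [set w | adj (y l) w].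
    by rewrite nbr_eq in_setD1 (inj_eq y_inj) ne_il in_setC y_out.
  by rewrite inE.
- move=> i ne_il; rewrite subn1; apply: leq_trans (deg (y i)) _.
  apply/subset_leq_card/subsetP => w wi; have := subsetP (nbr_B _ (y_out i)) _ wi.
  rewrite inE in wi; rewrite in_setU1 in_setD1 in_setC => w_cB.
  rewrite in_set wi andbT in_setU1 xl; case/orP: w_cB => [->//|/andP[w_yi wB]].
  move: wB w_yi; rewrite y_mem => /codomP[j ->]; rewrite (inj_eq y_inj) => ne_ji.
  by rewrite orbC imset_f // inE.
- move=> u w uw; rewrite -x_mem -y_mem -x_mem -y_mem.
  have cB i : adj c (y i) -> i != l.
    by apply: contraTneq => ->; rewrite -xl mu_nadj.
  have [uA|uB] := boolP (u \in c |: A); have [wA|wB] := boolP (w \in c |: A).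
  + by constructor 1.
  + constructor 3; move: uA; rewrite in_setU1 => /orP[/eqP u_c|uA]; last first.
      by rewrite (negbTE (no_edge _ _ uA wB)) in uw.
    move: wB; rewrite y_mem => /codomP[i w_y]; exists i.
      by apply: cB; rewrite -u_c -w_y.
    by rewrite u_c w_y xl.
  + constructor 3; move: wA; rewrite in_setU1 => /orP[/eqP w_c|wA]; last first.
      by rewrite adj_sym (negbTE (no_edge _ _ wA uB)) in uw.
    move: uB; rewrite y_mem => /codomP[i u_y]; exists i.
      by apply: cB; rewrite -w_c -u_y adj_sym.
    by rewrite w_c u_y xl setUC.
  + by constructor 2.
Qed.

(** The two sides have [k.*2.-1] vertices in total, so one has fewer than [k]; it takes the role of
    [A]. *)
Lemma cut_vertex_F1 (G : sgraph) (k : nat) (P : {set {set G}}) (mu : G -> G) :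
  0 < k -> #|G| = k.*2 -> balanced_partite k P -> all_degrees_ge (@adj G) k.-1 ->
  involutive mu -> (forall u, mu u != u) -> (forall u, ~~ adj u (mu u)) ->
  P = [set [set u; mu u] | u : G] -> has_cut_vertex (@adj G) ->
  family_F1 k P.
Proof.
move=> k_gt0 card_G P_bal deg muK mu_neq mu_nadj P_def [c [A [cA A_ne B_ne no_edge]]].
have [lt_A|ge_A] := ltnP #|A| k.
  exact: cut_vertex_F1_ordered muK mu_neq mu_nadj P_def cA A_ne B_ne no_edge lt_A.
have co_co : c |: ~: (c |: A) = ~: A.
  by apply/setP => u; rewrite !inE; have [->|] := eqVneq u c; rewrite ?cA.
apply: (cut_vertex_F1_ordered k_gt0 card_G P_bal deg muK mu_neq mu_nadj P_def
  (c := c) (A := ~: (c |: A))).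
- by rewrite in_setC negbK setU11.
- by have [b bB] := B_ne; exists b; rewrite in_setC.
- by have [a aA] := A_ne; exists a; rewrite co_co in_setC negbK.
- move=> a b; rewrite co_co !in_setC negbK => aB bA; rewrite adj_sym.
  exact: no_edge.
- by have := cardsC (c |: A); rewrite cardsU1 cA card_G; lia.
Qed.

(** * Near-independent sets and the third family *)

Lemma card_setU1_le (T : finType) (x : T) (A : {set T}) : #|x |: A| <= 1 + #|A|.
Proof. by rewrite cardsU1 leq_add2r leq_b1. Qed.

Lemma half_blocks (T : finType) (x0 : T) (mu : T -> T) (A : {set T}) (k : nat) :
  involutive mu -> (forall u, mu u != u) -> (forall u, u \in A -> mu u \in A) ->
  #|A| = k ->
  exists x : 'I_(k %/ 2) -> T,
    \bigcup_i [set x i; mu (x i)] = A.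
Proof.
move=> muK mu_neq A_mu card_A.
have [s card_s s_mem] := involution_half muK mu_neq A_mu.
have size_s : size s = k %/ 2 by rewrite -card_A card_s; lia.
exists (fun i => nth x0 s i); apply/setP => u; rewrite s_mem; apply/bigcupP/orP.
  case=> i _; have x_s : nth x0 s i \in s by rewrite mem_nth // size_s.
  rewrite !inE => /orP[/eqP ->|/eqP ->]; first by left.
  by right; rewrite muK.
have idx w : w \in s -> exists i : 'I_(k %/ 2), nth x0 s i = w.
  move=> ws; have lt_i : index w s < k %/ 2 by rewrite -size_s index_mem.
  by exists (Ordinal lt_i); rewrite /= nth_index.
case=> /idx[i i_u]; exists i => //; rewrite !inE i_u ?eqxx //.
by rewrite muK eqxx orbT.
Qed.

(** The labelling takes [X] as [I :\ b], [Y] as its complement, [y'] as [b] and [x'] as [a]. A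
    vertex of [I] other than [a] and [b] must see all [k.-1] vertices outside [I], so its partner
    lies in [I]; this makes [X] a union of parts. *)
Lemma near_independent_F3_ordered (G : sgraph) (k : nat) (P : {set {set G}})
    (mu : G -> G) (I : {set G}) (a b : G) :
  1 < k -> ~~ odd k -> #|G| = k.*2 -> balanced_partite k P ->
  all_degrees_ge (@adj G) k.-1 ->
  involutive mu -> (forall u, mu u != u) -> (forall u, ~~ adj u (mu u)) ->
  P = [set [set u; mu u] | u : G] ->
  #|I| = k.+1 -> a \in I -> b \in I -> a != b ->
  {in I &, forall u w, adj u w ->
     (u == a) && (w == b) || (u == b) && (w == a)} ->
  mu b \notin I -> family_F3 k P.
Proof.
move=> k_gt1 k_even card_G P_bal deg muK mu_neq mu_nadj P_def.
move=> card_I aI bI ne_ab I_edge mu_bI.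
have card_S : #|~: I| = k.-1 by have := cardsC I; rewrite card_I card_G; lia.
have full_adj u (N : {set G}) : [set w | adj u w] \subset N -> #|N| <= k.-1 ->
    forall w, w \in N -> adj u w.
  move=> sub_N le_N w wN; have /eqP eq_N : [set w | adj u w] == N.
    by rewrite eqEcard sub_N (leq_trans le_N).
  by rewrite -eq_N inE in wN.
have out_adj u : u \in I -> u != a -> u != b -> forall w, w \notin I -> adj u w.
  move=> uI u_a u_b w wI; apply: (full_adj u (~: I)); rewrite ?in_setC ?card_S //.
  apply/subsetP => w'; rewrite inE in_setC; apply: contraTN => w'I.
  apply/negP => /(I_edge _ _ uI w'I).
  by rewrite (negbTE u_a) (negbTE u_b).
have mu_in u : u \in I -> u != a -> u != b -> mu u \in I.
  by move=> uI u_a u_b; apply: contraLR (mu_nadj u) => /out_adj ->.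
(* Else [I] without [a] and [b] has odd size and is closed under [mu]. *)
have mu_aI : mu a \in I.
  apply/negPn/negP => mu_aI.
  have closed u : u \in I :\ a :\ b -> mu u \in I :\ a :\ b.
    rewrite !inE => /and3P[u_b u_a uI].
    rewrite mu_in // andbT !(inv_eq muK).
    by apply/andP; split; apply: contraTneq uI => ->.
  have [s card_s _] := involution_half muK mu_neq closed.
  have := cardsD1 a I; have := cardsD1 b (I :\ a).
  by rewrite card_s card_I aI !inE bI eq_sym ne_ab /=; move: k_even k_gt1; clear; lia.
have X_mu u : u \in I :\ b -> mu u \in I :\ b.
  rewrite !inE => /andP[u_b uI]; have [->|u_a] := eqVneq u a.
    by rewrite mu_aI andbT; apply: contraNneq mu_bI => <-; rewrite muK.
  rewrite mu_in // andbT; apply: contraNneq mu_bI => <-; by rewrite muK.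
have Y_mu u : u \in ~: (I :\ b) -> mu u \in ~: (I :\ b).
  by rewrite 2!in_setC; apply: contra => /X_mu; rewrite muK.
have card_X : #|I :\ b| = k by have := cardsD1 b I; rewrite card_I bI; lia.
have card_Y : #|~: (I :\ b)| = k.
  by have := cardsC (I :\ b); rewrite card_X card_G; lia.
have [x XX] := half_blocks b muK mu_neq X_mu card_X.
have [y YY] := half_blocks b muK mu_neq Y_mu card_Y.
have bY : b \in ~: (I :\ b) by rewrite !inE eqxx.
have [l _ bl] : exists2 l, true & b \in [set y l; mu (y l)].
  by have := bY; rewrite -YY => /bigcupP[l _ bl]; exists l.
have block u i z : u \in [set (z : 'I_(k %/ 2) -> G) i; mu (z i)] ->
    [set z i; mu (z i)] = [set u; mu u].
  by rewrite !inE => /orP[] /eqP ->; rewrite ?muK // setUC.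
(* The partner of [b] is one of the [k.-1] vertices outside [I], so [b] has only [k.-1] candidates,
   [a] among them, and needs them all. *)
have b_adj w : w \in a |: (~: I :\ mu b) -> adj b w.
  apply: full_adj => {w}.
    apply/subsetP => w; rewrite inE => bw; rewrite in_setU1 in_setD1 in_setC.
    have -> /= : w != mu b by apply: contraTneq bw => ->; apply: mu_nadj.
    rewrite orbC -implyNb negbK; apply/implyP => wI.
    by have := I_edge _ _ bI wI bw; rewrite eqxx eq_sym (negbTE ne_ab).
  have := cardsD1 (mu b) (~: I); rewrite card_S in_setC mu_bI => ->.
  exact: card_setU1_le.
(* This [c] becomes [y'']: since [b] is the only possible neighbour of [a] inside [I], at most one
   vertex outside [I] is missed by [a]. *)
have [c cS ac] : exists2 c, c \notin I & forall w, w \notin I -> w != c -> adj a w.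
  case no_nbr: [exists c in ~: I, ~~ adj a c].
    have /existsP[c /andP[]] := no_nbr; rewrite in_setC => cS nac; exists c => // w wS w_c.
    apply: (full_adj a (b |: (~: I :\ c))).
    - apply/subsetP => w'; rewrite inE => aw'; rewrite in_setU1 in_setD1 in_setC.
      have -> /= : w' != c by apply: contraNneq nac => <-.
      rewrite orbC -implyNb negbK; apply/implyP => w'I.
      by have := I_edge _ _ aI w'I aw'; rewrite eqxx (negbTE ne_ab) orbF.
    - have := cardsD1 c (~: I); rewrite card_S in_setC cS => ->.
      exact: card_setU1_le.
    - by rewrite in_setU1 in_setD1 in_setC w_c wS orbT.
  (* If [a] misses none, any vertex outside [I] will do, and the optional edge from [x'] to [y''] is
     then present. *)
  exists (mu b) => // w wS _; move: (negbT no_nbr); rewrite negb_exists.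
  by move=> /forallP /(_ w); rewrite in_setC wS /= negbK.
have in_Y w : (w \in ~: (I :\ b)) = (w == b) || (w \notin I).
  by rewrite in_setC in_setD1 negb_and negbK.
have c_b : c != b by apply: contraNneq cS => ->.
split=> //; exists (fun i => [set x i; mu (x i)]), (fun i => [set y i; mu (y i)]), l, b, c, a.
rewrite XX YY; split.
- rewrite P_def; apply/setP => B; rewrite inE; apply/imsetP/orP => [[u _ ->]|].
    have [uX|uY] := boolP (u \in I :\ b); [left | right].
      move: uX; rewrite -XX => /bigcupP[i _ ui]; apply/imsetP; exists i => //.
      by rewrite (block _ _ _ ui).
    move: uY; rewrite -in_setC -YY => /bigcupP[i _ ui]; apply/imsetP; exists i => //.
    by rewrite (block _ _ _ ui).
  by case=> /imsetP[i _ ->]; [exists (x i) | exists (y i)].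
- split=> //; last by rewrite in_setD1 ne_ab.
  by rewrite in_setD1 c_b in_Y cS orbT.
- move=> u w /or3P[/andP[uX]|/andP[/eqP-> ]|/andP[/eqP->]].
  + rewrite in_setD in_set2 in_Y negb_or => /andP[/andP[w_b w_c]].
    rewrite (negbTE w_b) /= => wI; move: uX; rewrite in_setD1 => /andP[u_b uI].
    by have [->|u_a] := eqVneq u a; [apply: ac | apply: out_adj].
  + rewrite in_setD1 in_setD1 => /and3P[w_a w_b wI]; rewrite adj_sym.
    exact: out_adj.
  + rewrite in_setU1 in_setD in_Y (block _ _ _ bl) in_set2 negb_or => w_ab.
    apply: b_adj; rewrite in_setU1 in_setD1 in_setC.
    case/orP: w_ab => [->//|/andP[/andP[w_b w_mu]]].
    by rewrite (negbTE w_b) w_mu /= => ->; rewrite orbT.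
- have XY u w : adj u w -> u \in I :\ b -> w \in ~: (I :\ b) ->
      [|| w \in ~: (I :\ b) :\: [set b; c],
          (w == c) && (u \in I :\ b :\ a),
          (w == b) && (u \in a |: (~: (I :\ b) :\: [set y l; mu (y l)]))
        | (u == a) && (w == c)].
    move=> uw uX wY; rewrite in_setD wY in_set2 andbT.
    have [w_b|w_b] := eqVneq w b.
      move: uw uX; rewrite w_b in_setD1 => ub /andP[u_b uI].
      have := I_edge _ _ uI bI ub; rewrite eqxx (negbTE u_b) orbF andbT => u_a.
      by rewrite in_setU1 u_a orbT.
    have [w_c|//] := eqVneq w c.
    by rewrite in_setD1 uX andbT; case: (u == a); rewrite ?orbT.
  have YY_opt u w : adj u w -> u \in ~: (I :\ b) -> w \in ~: (I :\ b) ->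
      [exists i, exists j, [&& i != j, u \in [set y i; mu (y i)]
                             & w \in [set y j; mu (y j)]]].
    move=> uw; rewrite -YY => /bigcupP[i _ ui] /bigcupP[j _ wj].
    apply/existsP; exists i; apply/existsP; exists j; rewrite ui wj !andbT.
    apply: contraTneq uw => ij; move: wj; rewrite -ij (block _ _ _ ui) in_set2.
    by case/orP => /eqP ->; rewrite ?adj_irrefl.
  move=> u w uw /=.
  have [uX|] := boolP (u \in I :\ b); have [wX|] := boolP (w \in I :\ b).
  + move: uX wX; rewrite !in_setD1 => /andP[u_b uI] /andP[w_b wI].
    by have := I_edge _ _ uI wI uw; rewrite (negbTE u_b) (negbTE w_b) andbF.
  + rewrite -in_setC => wY; have := XY u w uw uX wY.
    by case/or4P => ->; rewrite ?orbT.
  + rewrite -in_setC => uY; rewrite adj_sym in uw; have := XY w u uw wX uY.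
    by case/or4P => ->; rewrite ?orbT.
  + by rewrite -!in_setC => wY uY; rewrite (YY_opt u w uw uY wY) ?orbT.
Qed.

(** After exchanging [a] and [b] if necessary, the partner of [b] lies outside [I]: otherwise [I]
    would be closed under [mu], although [k.+1] is odd. *)
Lemma near_independent_F3 (G : sgraph) (k : nat) (P : {set {set G}})
    (mu : G -> G) :
  1 < k -> ~~ odd k -> #|G| = k.*2 -> balanced_partite k P ->
  all_degrees_ge (@adj G) k.-1 ->
  involutive mu -> (forall u, mu u != u) -> (forall u, ~~ adj u (mu u)) ->
  P = [set [set u; mu u] | u : G] ->
  near_independent_set (@adj G) k.+1 -> family_F3 k P.
Proof.
move=> k_gt1 k_even card_G P_bal deg muK mu_neq mu_nadj P_def.
move=> [I [a [b [card_I [aI bI ne_ab] I_edge]]]].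
have ordered := near_independent_F3_ordered k_gt1 k_even card_G P_bal deg muK
  mu_neq mu_nadj P_def card_I.
have [mu_bI|] := boolP (mu b \in I); last exact: ordered I_edge.
have [mu_aI|mu_aI] := boolP (mu a \in I); last first.
  apply: (ordered b a) => // [|u w uI wI uw]; first by rewrite eq_sym.
  by rewrite orbC; apply: I_edge.
(* If the partner of such a [u] were outside [I], only [k - 2] possible neighbours would remain. *)
have I_mu u : u \in I -> mu u \in I.
  move=> uI; have [->//|u_a] := eqVneq u a; have [->//|u_b] := eqVneq u b.
  apply: contraT => mu_uI.
  have sub_u : [set w | adj u w] \subset ~: I :\ mu u.
    apply/subsetP => w; rewrite inE => uw; rewrite in_setD1 in_setC.
    have -> /= : w != mu u by apply: contraTneq uw => ->; apply: mu_nadj.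
    apply/negP => wI; have := I_edge _ _ uI wI uw.
    by rewrite (negbTE u_a) (negbTE u_b).
  have := leq_trans (deg u) (subset_leq_card sub_u).
  have := cardsD1 (mu u) (~: I); rewrite in_setC mu_uI.
  by have := cardsC I; rewrite card_I card_G; nat_lia.
have [s card_s _] := involution_half muK mu_neq I_mu.
by move: k_even; rewrite card_I in card_s; nat_lia.
Qed.

(** * The exceptional graph and the conclusion *)

(** Vertices other than the two hubs have only three candidate neighbours, so degree 3 forces all of
    them. Each hub then sees every other non-hub, so its non-adjacent partner is the other hub,
    which excludes the optional edge. *)
Lemma F2_shaped_isomorphic (G : sgraph) (mu : G -> G) :
  #|G| = 8 -> all_degrees_ge (@adj G) 3 -> (forall u, mu u != u) ->
  (forall u, ~~ adj u (mu u)) -> F2_shaped (@adj G) -> isomorphic G F2.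
Proof.
move=> card_G deg mu_neq mu_nadj [f [f_inj f_edge]].
have f_bij : bijective f by apply: inj_card_bij; rewrite ?card_G ?card_ord.
have nbr_eq (i : 'I_8) : val i \notin [:: 0; 3] ->
    forall j, adj (f i) (f j) = F2_adj i j.
  move=> i_hub.
  have /eqP nbr_set : [set j | adj (f i) (f j)] == [set j | F2_adj i j].
    rewrite eqEcard; apply/andP; split.
      apply/subsetP => j; rewrite !inE => /f_edge.
      by rewrite (negbTE i_hub) orbF.
    apply: leq_trans (_ : 3 <= _).
      rewrite -sum1_card big_mkcond /= !big_ord_recl big_ord0 !inE /=.
      case: i i_hub => i lt_i /=.
      by case: i lt_i => [|[|[|[|[|[|[|[|i]]]]]]]] lt_i.
    apply: leq_trans (deg (f i)) _.
    rewrite -(on_card_preimset (f := f)); last exact: onW_bij.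
    by apply/subset_leq_card/subsetP => j; rewrite !inE.
  by move=> j; move/setP/(_ j): nbr_set; rewrite !inE.
have hub_adj (i j : 'I_8) : val i \notin [:: 0; 3] -> val j \in [:: 0; 3] ->
    F2_adj i j.
  case: i j => i lt_i [j lt_j].
  case: i lt_i => [|[|[|[|[|[|[|[|i]]]]]]]] lt_i //;
  by case: j lt_j => [|[|[|[|[|[|[|[|j]]]]]]]] lt_j.
have hub (i j : 'I_8) : val i \in [:: 0; 3] -> val j \in [:: 0; 3] ->
    ~~ adj (f i) (f j).
  move=> i_hub j_hub; have [->|ne_ij] := eqVneq i j; first by rewrite adj_irrefl.
  have [g _ gK] := f_bij.
  have : ~~ adj (f i) (mu (f i)) by [].
  rewrite -(gK (mu (f i))); set m := g _.
  have ne_m : m != i.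
    by apply/eqP => m_i; have := mu_neq (f i); rewrite -[X in _ != f X]m_i gK eqxx.
  have [m_hub|m_out] := boolP (val m \in [:: 0; 3]); last first.
    by rewrite adj_sym nbr_eq // hub_adj.
  have -> // : j = m.
  apply: val_inj; move: i_hub j_hub m_hub ne_ij ne_m; rewrite !inE -!val_eqE /=.
  by do 3![case/orP => /eqP ->].
have [g fK gK] := f_bij.
exists g; split; first by exists f.
move=> u w; rewrite -{2}(gK u) -{2}(gK w) /=.
have [u_hub|u_out] := boolP (val (g u) \in [:: 0; 3]); last by rewrite nbr_eq.
have [w_hub|w_out] := boolP (val (g w) \in [:: 0; 3]); last first.
  by rewrite (adj_sym (f _)) nbr_eq // F2_adj_sym.
rewrite (negbTE (hub _ _ u_hub w_hub)).
move: u_hub w_hub; case: (g u) => i lt_i; case: (g w) => j lt_j; rewrite !inE /=.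
by do 2![case/orP => /eqP ?]; subst.
Qed.

Lemma min_degree_le (G : sgraph) (u : G) : min_degree G <= degree u.
Proof.
rewrite /min_degree; have := mem_index_enum u.
elim: (index_enum G) => // w s IH; rewrite big_cons in_cons => /orP[/eqP <-|us].
  exact: geq_minl.
by apply: leq_trans (geq_minr _ _) (IH us).
Qed.

Theorem proposition1p2 (n k : nat) (G : sgraph) (P : {set {set G}})
    (n_ge8 : 8 <= n) (n_div4 : 4 %| n) (k_def : k = n %/ 2)
    (card_G : #|G| = n) (G_partite : balanced_partite k P)
    (G_mindeg : n %/ 2 + (n + 2) %/ (k + 2) - n %/ k <= min_degree G)
    (G_nonham : ~ hamiltonian G) :
  [\/ family_F1 k P, n = 8 /\ isomorphic G F2 | family_F3 k P].
Proof.
have [n_k k_even k_gt3] : [/\ n = k.*2, ~~ odd k & 3 < k] by split; lia.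
have n_div_k : n %/ k = 2 by rewrite n_k -muln2 mulKn //; lia.
(* As [n + 2 = (k + 2) + k], the first quotient is 1 and the bound reads [k + 1 - 2]. *)
have deg : all_degrees_ge (@adj G) k.-1.
  move=> u; apply: leq_trans (min_degree_le u); apply: leq_trans G_mindeg.
  have -> : (n + 2) %/ (k + 2) = 1.
    have -> : n + 2 = 1 * (k + 2) + k by lia.
    by rewrite divnMDl ?divn_small; lia.
  by rewrite n_div_k; lia.
have [P_part _ P_blocks] := G_partite.
have [A A_P|mu [muK mu_neq P_def]] := partition_mate P_part.
  by have [_ ->] := P_blocks A A_P; rewrite card_G.
have mu_nadj u : ~~ adj u (mu u).
  have uP : [set u; mu u] \in P by rewrite P_def; apply/imsetP; exists u.
  by have [indep _] := P_blocks _ uP; apply: indep; rewrite !inE eqxx ?orbT.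
have no_cycle : ~ has_cycle (@adj G) k.*2.
  by move=> c; apply: G_nonham; apply: has_cycle_hamiltonian c; lia.
rewrite n_k in card_G.
have k_gt0 : 0 < k by lia.
have k_gt1 : 1 < k by lia.
have [cut|indep|[k4 F2_G]] := nonhamiltonian_obstruction (@adj_sym G)
  (@adj_irrefl G) k_gt3 card_G deg no_cycle.
- constructor 1.
  exact: cut_vertex_F1 k_gt0 card_G G_partite deg muK mu_neq mu_nadj P_def cut.
- constructor 3.
  exact: near_independent_F3 k_gt1 k_even card_G G_partite deg muK mu_neq
    mu_nadj P_def indep.
- constructor 2; split; first by rewrite n_k k4.
  subst k; rewrite k4 in deg card_G.
  exact: F2_shaped_isomorphic card_G deg mu_neq mu_nadj F2_G.
Qed.
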